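(* Let $A$ be a vector space and let $\Phi:A\otimes A\longrightarrow A\otimes A$ be a linear map. Define products $\circ_a:\mathfrak{g}_{A,\mathcal{D}}\otimes\mathfrak{g}_{A,\mathcal{D}}\longrightarrow\mathfrak{g}_{A,\mathcal{D}}$, for any $a\in A$, in an inductive way: for any $A$-typed and $\mathcal{D}$-decorated rooted trees $T,T_1,\ldots,T_k$, any $d\in\mathcal{D}$ and any $a,a_1,\ldots,a_k\in A$, \begin{align*} T\circ_a B_d(a_1T_1,\ldots,a_kT_k)&=B_d(aT,a_1T_1,\ldots,a_kT_k)\\ &+\sum_{i=1}^k\sum B_d\big(a_1T_1,\ldots,a_{i-1}T_{i-1},(a'\rightarrow a_i')\,(T\circ_{a''\triangleright a_i''}T_i),a_{i+1}T_{i+1},\ldots,a_kT_k\big), \end{align*} where $\Phi(a\otimes a_i)=\sum a'\rightarrow a_i'\otimes a''\triangleright a_i''$. Then, for any set $\mathcal{D}$, $(\mathfrak{g}_{A,\mathcal{D}},\circ)$ is a $\Phi$-prelie algebra if, and only if, $(A,\Phi)$ is an $\ell$CEDS. Moreover, if this holds, then $\mathfrak{g}_{A,\mathcal{D}}$ is the free $\Phi$-prelie algebra generated by the trees with one vertex, decorated by an element $d$ of $\mathcal{D}$.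
   Context: $\mathbb{K}$ is a commutative field of characteristic zero and all vector spaces are over $\mathbb{K}$; $\tau:A\otimes A\to A\otimes A$ is the flip. An $\ell$CEDS (linear commutative extended diassociative semigroup) is a pair $(A,\Phi)$ with $A$ a vector space and $\Phi:A\otimes A\to A\otimes A$ linear such that $(\mathrm{Id}\otimes\Phi)\circ(\Phi\otimes\mathrm{Id})\circ(\mathrm{Id}\otimes\Phi)=(\Phi\otimes\mathrm{Id})\circ(\mathrm{Id}\otimes\tau)\circ(\Phi\otimes\mathrm{Id})$ and $(\mathrm{Id}\otimes\Phi)\circ(\mathrm{Id}\otimes\tau)\circ(\tau\otimes\mathrm{Id})\circ(\Phi\otimes\mathrm{Id})=(\tau\otimes\mathrm{Id})\circ(\Phi\otimes\mathrm{Id})\circ(\mathrm{Id}\otimes\Phi)\circ(\mathrm{Id}\otimes\tau)$. Sweedler notation: for $a,b\in A$, $\Phi(a\otimes b)=\sum a'\rightarrow b'\otimes a''\triangleright b''$; this is purely formal (the symbols $\rightarrow,\triangleright$, and the coproducts $a'\otimes a''$, need not exist separately). For any linear map $\Phi:A\otimes A\to A\otimes A$, a $\Phi$-prelie algebra is a vector space $V$ with a linear map $A\to\mathcal{L}(V\otimes V,V)$, $a\mapsto\circ_a$, such that for all $x,y,z\in V$, $a,b\in A$: $$x\circ_a(y\circ_b z)-\sum(x\circ_{a''\triangleright b''}y)\circ_{a'\rightarrow b'}z=y\circ_b(x\circ_a z)-\sum(y\circ_{b''\triangleright a''}x)\circ_{b'\rightarrow a'}z.$$ For a set $\mathcal{D}$,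 an $A$-typed and $\mathcal{D}$-decorated rooted tree is a (non-planar) rooted tree $T$ with a map from its vertices to $\mathcal{D}$ (decorations) and a map from its edges to $A$ (types). $\mathfrak{g}_{A,\mathcal{D}}$ is the vector space generated by (isoclasses of) these trees, the trees being linear in the type of each edge; that is, $\mathfrak{g}_{A,\mathcal{D}}=\bigoplus_T\mathbb{K}T\otimes_{\mathrm{Aut}(T)}\bigotimes_{e\in E(T)}A$, the sum being over isoclasses of $\mathcal{D}$-decorated rooted trees $T$, where $\mathrm{Aut}(T)$ acts trivially on $\mathbb{K}T$ and permutes the tensor factors. $B_d(a_1T_1,\ldots,a_kT_k)$ is the tree obtained by grafting $T_1,\ldots,T_k$ on a common root decorated by $d\in\mathcal{D}$, the edge from the root to the root of $T_i$ being of type $a_i$; it is symmetric in the $a_iT_i$ and extended multilinearly, giving $B_d:S(A\otimes\mathfrak{g}_{A,\mathcal{D}})\to\mathfrak{g}_{A,\mathcal{D}}$. For $k=0$, it is the single vertex decorated by $d$.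
   Formalization: The equivalence is stated for nonempty D: for D empty the space of trees is zero, hence Φ-prelie for every Φ, even when (A,Φ) is not an ℓCEDS. That ℓCEDS implies Φ-prelie and free is stated for every set D. *)

(* Defs.v *)
From HB Require Import structures.
From mathcomp Require Import all_boot all_order all_algebra.
From mathcomp Require Import finmap boolp.
From mathcomp Require Import monalg.

Set Implicit Arguments.
Unset Strict Implicit.
Unset Printing Implicit Defensive.

Import GRing.Theory.
Local Open Scope quotient_scope.
Local Open Scope ring_scope.

(* MathComp has no tensor product of arbitrary modules; tensor products and
   the space of typed trees are both obtained from the free vector space
   {malg K[G]} on a type G of generators, modulo the span of relations. *)

Section Presentation.
Variables (K : fieldType) (G : choiceType).
Implicit Type R : {malg K[G]} -> Prop.

Inductive span R : {malg K[G]} -> Prop :=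
| span0 : span R 0
| spanS c u v : R u -> span R v -> span R (c *: u + v).

Definition span_pred R : {pred {malg K[G]}} := fun u => `[< span R u >].

Lemma spanZD R c u v : span R u -> span R v -> span R (c *: u + v).
Proof.
elim=> [|b w w' Rw _ IH] Rv; first by rewrite scaler0 add0r.
by rewrite scalerDr scalerA -addrA; apply: spanS => //; apply: IH.
Qed.

Lemma span_predZD R c u v :
  u \in span_pred R -> v \in span_pred R -> c *: u + v \in span_pred R.
Proof. by move=> /asboolP Ru /asboolP Rv; apply/asboolP/spanZD. Qed.

Lemma span_pred_zmod R : zmod_closed (span_pred R).
Proof.
split=> [|u v Ru Rv]; first by apply/asboolP; constructor.
by rewrite addrC -scaleN1r; apply: span_predZD.
Qed.

HB.instance Definition _ R :=
  GRing.isZmodClosed.Build {malg K[G]} (span_pred R) (span_pred_zmod R).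

Definition presented R : Type := Quotient.quot (span_pred R : zmodClosed _).

HB.instance Definition _ R := GRing.Zmodule.on (presented R).

Definition proj R (u : {malg K[G]}) : presented R :=
  \pi_(Quotient.quot (span_pred R : zmodClosed _)) u.

Definition rep R (x : presented R) : {malg K[G]} :=
  repr (x : Quotient.quot (span_pred R : zmodClosed _)).

Lemma repK R (x : presented R) : proj R (rep x) = x.
Proof. exact: reprK. Qed.

Lemma proj_eq R u v : (proj R u = proj R v) <-> span R (u - v).
Proof.
split=> [/eqP|h].
  by rewrite -[_ == _]Quotient.idealrBE => /asboolP.
by apply/eqP; rewrite -[_ == _]Quotient.idealrBE; apply/asboolP.
Qed.

Lemma projB R : {morph proj R : u v / u - v}.
Proof. by move=> u v; rewrite /proj !piE. Qed.

Lemma projD R : {morph proj R : u v / u + v}.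
Proof. by move=> u v; rewrite /proj !piE. Qed.

Definition pscale R c (x : presented R) : presented R := proj R (c *: rep x).

Lemma pscaleE R c u : pscale c (proj R u) = proj R (c *: u).
Proof.
apply/proj_eq; rewrite -scalerBr -[X in span R X]addr0.
by apply: spanZD; [apply/proj_eq; rewrite repK | constructor].
Qed.

Fact pscaleA R a b (x : presented R) :
  pscale a (pscale b x) = pscale (a * b) x.
Proof. by rewrite -[x]repK !pscaleE scalerA. Qed.

Fact pscale1 R : left_id 1 (@pscale R).
Proof. by move=> x; rewrite -[x]repK pscaleE scale1r. Qed.

Fact pscaleDr R : right_distributive (@pscale R) +%R.
Proof.
by move=> c x y; rewrite -[x]repK -[y]repK -projD !pscaleE scalerDr projD.
Qed.

Fact pscaleDl R (x : presented R) :
  {morph (@pscale R)^~ x : a b / a + b}.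
Proof. by move=> a b; rewrite -[x]repK !pscaleE scalerDl projD. Qed.

HB.instance Definition _ R := GRing.Zmodule_isLmodule.Build K (presented R)
  (@pscaleA R) (@pscale1 R) (@pscaleDr R) (@pscaleDl R).

Lemma proj_is_linear R : linear (proj R).
Proof. by move=> c u v; rewrite projD -pscaleE. Qed.

HB.instance Definition _ R := GRing.isLinear.Build K {malg K[G]} (presented R)
  *:%R (proj R) (proj_is_linear R).

Definition gen R (g : G) : presented R := proj R << g >>.

Lemma gen_eq R g g' : R (<< g >> - << g' >>) -> gen R g = gen R g'.
Proof.
move=> Rgg'; apply/proj_eq; rewrite -[X in span _ X]addr0.
by rewrite -[X in span _ (X + _)]scale1r; apply: spanS => //; constructor.
Qed.

Lemma gen_lin R c g g1 g2 : R (<< g >> - (c *: << g1 >> + << g2 >>)) ->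
  gen R g = c *: gen R g1 + gen R g2.
Proof.
move=> Rg; rewrite /gen -linearP; apply/proj_eq; rewrite -[X in span _ X]addr0.
by rewrite -[X in span _ (X + _)]scale1r; apply: spanS => //; constructor.
Qed.

(* Linear extension of a map from generators; total, but only meaningful when
   f respects the relations, see lift_gen and lift_is_linear. *)
Definition mlift (V : lmodType K) (f : G -> V) (u : {malg K[G]}) : V :=
  \sum_(k <- msupp u) u@_k *: f k.

Definition lift R (V : lmodType K) (f : G -> V) (x : presented R) : V :=
  mlift f (rep x).

Definition respects R (V : lmodType K) (f : G -> V) : Prop :=
  forall u, R u -> mlift f u = 0.

Section Lift.
Variables (V : lmodType K).
Implicit Type f : G -> V.

Lemma mliftEw f u (dom : {fset G}) : (msupp u `<=` dom)%fset ->
  mlift f u = \sum_(k <- dom) u@_k *: f k.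
Proof.
move=> sud; apply: big_fset_incl => // k _ ku.
by rewrite mcoeff_outdom // scale0r.
Qed.

Lemma mlift_is_linear f : linear (mlift f).
Proof.
move=> c u v; pose dom := (msupp u `|` msupp v `|` msupp (c *: u + v))%fset.
rewrite (@mliftEw _ _ dom) ?(@mliftEw _ u dom) ?(@mliftEw _ v dom) //.
- rewrite scaler_sumr -big_split /=; apply: eq_bigr => k _.
  by rewrite mcoeffD mcoeffZ scalerDl scalerA.
- by rewrite /dom -fsetUA (fsetUCA (msupp u)); apply: fsubsetUl.
- by rewrite /dom -fsetUA; apply: fsubsetUl.
- exact: fsubsetUr.
Qed.

HB.instance Definition _ f := GRing.isLinear.Build K {malg K[G]} V
  *:%R (mlift f) (mlift_is_linear f).

Lemma mliftU f g : mlift f << g >> = f g.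
Proof.
rewrite (@mliftEw _ _ [fset g]%fset) ?msuppU_le //.
by rewrite big_seq_fset1 mcoeffUU scale1r.
Qed.

Lemma mlift_eqE f g g' : mlift f (<< g >> - << g' >>) = f g - f g'.
Proof. by rewrite linearB /= !mliftU. Qed.

Lemma mlift_linE f c g g1 g2 :
  mlift f (<< g >> - (c *: << g1 >> + << g2 >>)) = f g - (c *: f g1 + f g2).
Proof. by rewrite linearB linearP /= !mliftU. Qed.

Lemma mlift_span R f u : respects R f -> span R u -> mlift f u = 0.
Proof.
move=> Rf; elim=> [|c v w Rv _ IH]; first exact: linear0.
by rewrite linearP /= Rf // IH scaler0 addr0.
Qed.

Lemma lift_proj R f u : respects R f -> lift f (proj R u) = mlift f u.
Proof.
move=> Rf; apply/eqP; rewrite -subr_eq0 /lift -linearB /=; apply/eqP.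
by apply: (mlift_span Rf); apply/proj_eq; rewrite repK.
Qed.

Lemma lift_gen R f g : respects R f -> lift f (gen R g) = f g.
Proof. by move=> Rf; rewrite lift_proj // mliftU. Qed.

Lemma lift_is_linear R f : respects R f -> linear (lift f : presented R -> V).
Proof.
move=> Rf c x y; rewrite -[x]repK -[y]repK -linearP !lift_proj //.
exact: linearP.
Qed.

Lemma lift_linl R c f f' (x : presented R) :
  lift (fun g => c *: f g + f' g) x = c *: lift f x + lift f' x.
Proof.
rewrite /lift /mlift scaler_sumr -big_split /=; apply: eq_bigr => k _.
by rewrite scalerDr !scalerA mulrC.
Qed.

Lemma lift_comm R R' (f : G -> G -> V) (x : presented R) (y : presented R') :
  lift (fun g => lift (f g) y) x = lift (fun g' => lift (f^~ g') x) y.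
Proof.
rewrite /lift /mlift; under eq_bigr do rewrite scaler_sumr.
rewrite exchange_big /=; apply: eq_bigr => k _; rewrite scaler_sumr.
by apply: eq_bigr => l _; rewrite !scalerA mulrC.
Qed.

Lemma presented_ext R (f f' : presented R -> V) :
  linear f -> linear f' -> (forall g, f (gen R g) = f' (gen R g)) -> f =1 f'.
Proof.
have zero h : linear h -> h (0 : presented R) = 0 :> V.
  move=> lh; have := lh (-1) 0 0.
  by rewrite scaler0 addr0 scaleN1r addNr.
move=> lf lf' ff' x; rewrite -[x]repK; move: (rep x) => u.
rewrite [u]monalgE; elim: (enum_fset _) => [|k s IH].
  by rewrite big_nil linear0 !zero.
have -> : \sum_(l <- k :: s) << u@_l *g l >> =
    u@_k *: << k >> + \sum_(l <- s) << u@_l *g l >>.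
  rewrite big_cons; congr (_ + _); apply/malgP=> l.
  by rewrite mcoeffZ !mcoeffU mulr_natr.
by rewrite linearP lf lf' IH ff'.
Qed.

End Lift.
End Presentation.

Definition bilinear_fun (K : fieldType) (U V W : lmodType K)
    (F : U -> V -> W) : Prop :=
  (forall v, linear (F^~ v)) /\ (forall u, linear (F u)).

Section Tensor.
Variable K : fieldType.

Inductive tensor_rel (V W : lmodType K) : {malg K[(V * W)%type]} -> Prop :=
| tensor_rell c v v' w :
    tensor_rel (<< (c *: v + v', w) >> - (c *: << (v, w) >> + << (v', w) >>))
| tensor_relr c v w w' :
    tensor_rel (<< (v, c *: w + w') >> - (c *: << (v, w) >> + << (v, w') >>)).

Definition tensor (V W : lmodType K) : lmodType K := presented (@tensor_rel V W).
End Tensor.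
Arguments tensor {K} (V W)%_type.

Notation "V ⊗ W" := (tensor V W)
  (at level 40, left associativity) : type_scope.

Section TensorTheory.
Variable K : fieldType.
Implicit Types V W U : lmodType K.

Definition tens V W (v : V) (w : W) : (V ⊗ W)%type :=
  gen (@tensor_rel K V W) (v, w).
Local Notation "v ⊗ w" := (tens v w) : ring_scope.

(* The linear map induced by a bilinear map F. *)
Definition tlift V W U (F : V -> W -> U) : (V ⊗ W)%type -> U :=
  lift (fun p : V * W => F p.1 p.2).

Lemma tlift_respects V W U (F : V -> W -> U) : bilinear_fun F ->
  respects (@tensor_rel K V W) (fun p => F p.1 p.2).
Proof.
move=> [Fl Fr] _ [c v v' w|c v w w']; rewrite mlift_linE /=.
  by rewrite [F _ w]Fl subrr.
by rewrite Fr subrr.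
Qed.

Lemma tens_bilinear V W : bilinear_fun (@tens V W).
Proof.
by split=> [w c v v'|v c w w'];
  [exact: (gen_lin (tensor_rell c v v' w))|exact: (gen_lin (tensor_relr c v w w'))].
Qed.

Lemma tlift_tens V W U (F : V -> W -> U) v w :
  bilinear_fun F -> tlift F (v ⊗ w) = F v w.
Proof. by move=> Fb; rewrite /tlift lift_gen //; apply: tlift_respects. Qed.

Lemma tlift_is_linear V W U (F : V -> W -> U) :
  bilinear_fun F -> linear (tlift F).
Proof. by move=> Fb; apply/lift_is_linear/tlift_respects. Qed.

Lemma tlift_linl V W U c (F F' : V -> W -> U) t :
  tlift (fun v w => c *: F v w + F' v w) t = c *: tlift F t + tlift F' t.
Proof. exact: lift_linl. Qed.

Lemma tlift_ext V W U (F F' : V -> W -> U) t :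
  (forall v w, F v w = F' v w) -> tlift F t = tlift F' t.
Proof.
move=> FF'; suff -> : F = F' by [].
by apply/funext => v; apply/funext => w.
Qed.

Lemma tensor_ext V W U (f f' : V ⊗ W -> U) :
  linear f -> linear f' -> (forall v w, f (v ⊗ w) = f' (v ⊗ w)) -> f =1 f'.
Proof. by move=> lf lf' ff'; apply: presented_ext => // -[v w]; apply: ff'. Qed.

(* Conversion may otherwise unfold the quotient when comparing tensors. *)
#[global] Opaque tensor tens tlift.

Definition tmap V W V' W' (f : V -> V') (g : W -> W') : V ⊗ W -> V' ⊗ W' :=
  tlift (fun v w => f v ⊗ g w).

Definition flip V W : V ⊗ W -> W ⊗ V := tlift (fun v w => w ⊗ v).

Definition assoc U V W : (U ⊗ V) ⊗ W -> U ⊗ (V ⊗ W) :=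
  tlift (fun t w => tlift (fun u v => u ⊗ (v ⊗ w)) t).

Definition assoc_inv U V W : U ⊗ (V ⊗ W) -> (U ⊗ V) ⊗ W :=
  tlift (fun u t => tlift (fun v w => (u ⊗ v) ⊗ w) t).

(* f ⊗ Id and Id ⊗ f as endomaps of A ⊗ A ⊗ A := (A ⊗ A) ⊗ A. *)
Definition tens_id (A : lmodType K) (f : A ⊗ A -> A ⊗ A) :
    (A ⊗ A) ⊗ A -> (A ⊗ A) ⊗ A := tmap f id.

Definition id_tens (A : lmodType K) (f : A ⊗ A -> A ⊗ A) :
    (A ⊗ A) ⊗ A -> (A ⊗ A) ⊗ A :=
  @assoc_inv A A A \o tmap id f \o @assoc A A A.

Lemma tmap_tens V W V' W' (f : {linear V -> V'}) (g : {linear W -> W'}) v w :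
  tmap f g (v ⊗ w) = f v ⊗ g w.
Proof.
apply: tlift_tens; split=> [w' c u u'|u c w1 w2]; rewrite linearP.
  exact: (tens_bilinear V' W').1.
exact: (tens_bilinear V' W').2.
Qed.

Lemma flip_tens V W (v : V) (w : W) : flip (v ⊗ w) = w ⊗ v.
Proof.
apply: tlift_tens; split=> [w' c u u'|u c w1 w2].
  exact: (tens_bilinear W V).2.
exact: (tens_bilinear W V).1.
Qed.

Lemma assoc_tens U V W (u : U) (v : V) (w : W) :
  assoc ((u ⊗ v) ⊗ w) = u ⊗ (v ⊗ w).
Proof.
have Fb (w' : W) : bilinear_fun (fun (u : U) (v : V) => u ⊗ (v ⊗ w')).
  split=> [y|y] c x x' /=; first exact: (tens_bilinear U _).1.
  by rewrite (tens_bilinear V W).1 (tens_bilinear U _).2.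
have Gb : bilinear_fun (fun t (w : W) =>
    tlift (fun (u : U) (v : V) => u ⊗ (v ⊗ w)) t).
  split=> [w'|t c w1 w2] /=; first exact: tlift_is_linear.
  apply: etrans (tlift_linl _ _ _ _).
  apply: tlift_ext => x y.
  by rewrite (tens_bilinear V W).2 (tens_bilinear U _).2.
by apply: etrans (tlift_tens _ _ Gb) _; exact: (tlift_tens _ _ (Fb w)).
Qed.

Lemma assoc_inv_tens U V W (u : U) (v : V) (w : W) :
  assoc_inv (u ⊗ (v ⊗ w)) = (u ⊗ v) ⊗ w.
Proof.
have Fb (u' : U) : bilinear_fun (fun (v : V) (w : W) => (u' ⊗ v) ⊗ w).
  split=> [y|y] c x x' /=; last exact: (tens_bilinear _ W).2.
  by rewrite (tens_bilinear U V).2 (tens_bilinear _ W).1.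
have Gb : bilinear_fun (fun (u : U) t =>
    tlift (fun (v : V) (w : W) => (u ⊗ v) ⊗ w) t).
  split=> [t c u1 u2|u'] /=; last exact: tlift_is_linear.
  apply: etrans (tlift_linl _ _ _ _).
  apply: tlift_ext => x y.
  by rewrite (tens_bilinear U V).1 (tens_bilinear _ W).1.
by apply: etrans (tlift_tens _ _ Gb) _; exact: (tlift_tens _ _ (Fb u)).
Qed.

Definition lCEDS (A : lmodType K) (Phi : {linear (A ⊗ A)%type -> (A ⊗ A)%type}) : Prop :=
  let tau := @flip A A in
  (id_tens Phi \o tens_id Phi \o id_tens Phi
     =1 tens_id Phi \o id_tens tau \o tens_id Phi) /\
  (id_tens Phi \o id_tens tau \o tens_id tau \o tens_id Phi
     =1 tens_id tau \o tens_id Phi \o id_tens Phi \o id_tens tau).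

(* The Sweedler sum over Phi (a ⊗ b) = \sum p ⊗ q, where p stands for
   a' -> b' and q for a'' |> b'', of an expression F p q bilinear in (p, q). *)
Definition sweedler (A V : lmodType K) (Phi : {linear (A ⊗ A)%type -> (A ⊗ A)%type})
  (a b : A) (F : A -> A -> V) : V := tlift F (Phi (a ⊗ b)).

Lemma sweedler_linl (A V : lmodType K)
    (Phi : {linear (A ⊗ A)%type -> (A ⊗ A)%type}) a b c (F F' : A -> A -> V) :
  sweedler Phi a b (fun p q => c *: F p q + F' p q) =
    c *: sweedler Phi a b F + sweedler Phi a b F'.
Proof. exact: tlift_linl. Qed.

Lemma sweedler_lina (A V : lmodType K)
    (Phi : {linear (A ⊗ A)%type -> (A ⊗ A)%type}) b (F : A -> A -> V) :
  bilinear_fun F -> linear (fun a => sweedler Phi a b F).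
Proof.
move=> Fb c a a'; rewrite /sweedler (tens_bilinear A A).1 linearP.
exact: tlift_is_linear.
Qed.

Lemma sweedler_linb (A V : lmodType K)
    (Phi : {linear (A ⊗ A)%type -> (A ⊗ A)%type}) a (F : A -> A -> V) :
  bilinear_fun F -> linear (fun b => sweedler Phi a b F).
Proof.
move=> Fb c b b'; rewrite /sweedler (tens_bilinear A A).2 linearP.
exact: tlift_is_linear.
Qed.

Lemma sweedlerE (A V : lmodType K)
    (Phi : {linear (A ⊗ A)%type -> (A ⊗ A)%type}) a b (F : A -> A -> V)
    (s : seq (A * A)) :
    bilinear_fun F -> Phi (a ⊗ b) = \sum_(e <- s) e.1 ⊗ e.2 ->
  sweedler Phi a b F = \sum_(e <- s) F e.1 e.2.
Proof.
move=> Fb; rewrite /sweedler => ->; elim: s => [|e s IH].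
  have := tlift_is_linear Fb (-1) 0 0.
  by rewrite !big_nil scaler0 addr0 scaleN1r addNr.
rewrite !big_cons -IH -[e.1 ⊗ e.2]scale1r tlift_is_linear //.
by rewrite scale1r tlift_tens.
Qed.

Record phi_prelie (A : lmodType K) (Phi : {linear (A ⊗ A)%type -> (A ⊗ A)%type})
    (V : lmodType K) (op : A -> V -> V -> V) : Prop := PhiPrelie {
  prelie_linA : forall x y, linear (fun a => op a x y);
  prelie_linl : forall a y, linear (fun x => op a x y);
  prelie_linr : forall a x, linear (fun y => op a x y);
  prelieE : forall a b x y z,
    op a x (op b y z) - sweedler Phi a b (fun p q => op p (op q x y) z)
    = op b y (op a x z) - sweedler Phi b a (fun p q => op p (op q y x) z)
}.

Definition free_phi_prelie (A : lmodType K)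
    (Phi : {linear (A ⊗ A)%type -> (A ⊗ A)%type})
    (V : lmodType K) (op : A -> V -> V -> V) (X : Type) (i : X -> V) : Prop :=
  phi_prelie Phi op /\
  forall (W : lmodType K) (opW : A -> W -> W -> W), phi_prelie Phi opW ->
  forall f : X -> W,
    let extends (h : {linear V -> W}) :=
      (forall x, h (i x) = f x) /\
      (forall a x y, h (op a x y) = opW a (h x) (h y)) in
    exists2 h : {linear V -> W}, extends h &
      forall h' : {linear V -> W}, extends h' -> h' =1 h.

End TensorTheory.

Notation "v ⊗ w" := (tens v w) : ring_scope.

(* Planar representatives of typed decorated rooted trees: each child comes
   with the type of the edge leading to it. *)
Inductive ptree (A D : Type) : Type := Node of D & seq (A * ptree A D).

HB.instance Definition _ A D := gen_eqMixin (ptree A D).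
HB.instance Definition _ A D := gen_choiceMixin (ptree A D).

Section Trees.
Variables (K : fieldType) (A : lmodType K) (D : Type).
Local Notation tree := (ptree A D).

Inductive tree_swap : tree -> tree -> Prop :=
| swap_here d s1 x y s2 :
    tree_swap (Node d (s1 ++ [:: x, y & s2])) (Node d (s1 ++ [:: y, x & s2]))
| swap_deep d s1 a T T' s2 : tree_swap T T' ->
    tree_swap (Node d (s1 ++ (a, T) :: s2)) (Node d (s1 ++ (a, T') :: s2)).

(* tree_lin c T T1 T2: the trees only differ by the type of one edge, which is
   c *: a1 + a2 in T, a1 in T1 and a2 in T2. *)
Inductive tree_lin (c : K) : tree -> tree -> tree -> Prop :=
| lin_here d s1 a1 a2 T s2 :
    tree_lin c (Node d (s1 ++ (c *: a1 + a2, T) :: s2))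
               (Node d (s1 ++ (a1, T) :: s2)) (Node d (s1 ++ (a2, T) :: s2))
| lin_deep d s1 a T T1 T2 s2 : tree_lin c T T1 T2 ->
    tree_lin c (Node d (s1 ++ (a, T) :: s2))
               (Node d (s1 ++ (a, T1) :: s2)) (Node d (s1 ++ (a, T2) :: s2)).

Inductive tree_rel : {malg K[tree]} -> Prop :=
| tree_rel_swap T T' : tree_swap T T' -> tree_rel (<< T >> - << T' >>)
| tree_rel_lin c T T1 T2 : tree_lin c T T1 T2 ->
    tree_rel (<< T >> - (c *: << T1 >> + << T2 >>)).

(* g_{A,D}: exchanging adjacent subtrees generates the isomorphisms of rooted
   trees, so these are isoclasses of trees made linear in each edge type. *)
Definition typed_trees : lmodType K := presented tree_rel.
Local Notation g := typed_trees.

Definition tcls (T : tree) : g := gen tree_rel T.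

Definition vertex (d : D) : g := tcls (Node d [::]).

Lemma tree_respects (V : lmodType K) (f : tree -> V) :
    (forall T T', tree_swap T T' -> f T = f T') ->
    (forall c T T1 T2, tree_lin c T T1 T2 -> f T = c *: f T1 + f T2) ->
  respects tree_rel f.
Proof.
move=> fs fl _ [T T' /fs e|c T T1 T2 /fl e].
  by rewrite mlift_eqE e subrr.
by rewrite mlift_linE e subrr.
Qed.

Lemma tcls_swap T T' : tree_swap T T' -> tcls T = tcls T'.
Proof. by move=> TT'; exact: (gen_eq (tree_rel_swap TT')). Qed.

Lemma tcls_lin c T T1 T2 :
  tree_lin c T T1 T2 -> tcls T = c *: tcls T1 + tcls T2.
Proof. by move=> TT'; exact: (gen_lin (tree_rel_lin TT')). Qed.

Fixpoint expand (V : lmodType K) (s : seq (A * g)) (k : seq (A * tree) -> V) : V :=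
  if s is (a, u) :: s' then
    lift (fun T => expand s' (fun r => k ((a, T) :: r))) u
  else k [::].

(* B_d, extended multilinearly to sequences of elements of A x g. *)
Definition Bplus (d : D) (s : seq (A * g)) : g :=
  expand s (fun r => tcls (Node d r)).

Section Expand.
Variable V : lmodType K.
Implicit Types (k : seq (A * tree) -> V) (s : seq (A * g)).

Lemma expand_ext s k k' : k =1 k' -> expand s k = expand s k'.
Proof. by move=> kk'; have -> : k = k' by apply/funext. Qed.

Lemma expand_linl s c k k' :
  expand s (fun r => c *: k r + k' r) = c *: expand s k + expand s k'.
Proof.
elim: s k k' => [//|[a u] s IH] k k' /=; rewrite -lift_linl.
by congr lift; apply/funext => T; rewrite IH.
Qed.

Record edgewise k : Prop := Edgewise {
  edgewise_swap : forall r1 a T T' r2, tree_swap T T' ->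
    k (r1 ++ (a, T) :: r2) = k (r1 ++ (a, T') :: r2);
  edgewise_lin : forall r1 a c T T1 T2 r2, tree_lin c T T1 T2 ->
    k (r1 ++ (a, T) :: r2) =
      c *: k (r1 ++ (a, T1) :: r2) + k (r1 ++ (a, T2) :: r2);
  edgewise_linA : forall r1 T r2, linear (fun a => k (r1 ++ (a, T) :: r2))
}.

Lemma edgewise_cons k x : edgewise k -> edgewise (fun r => k (x :: r)).
Proof.
case=> ks kl kA; split=> [r1 a T T' r2|r1 a c T T1 T2 r2|r1 T r2 c a a'].
- exact: (ks (x :: r1)).
- exact: (kl (x :: r1)).
- exact: (kA (x :: r1)).
Qed.

Lemma expand_respects k s a : edgewise k ->
  respects tree_rel (fun T => expand s (fun r => k ((a, T) :: r))).
Proof.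
case=> ks kl _; apply: tree_respects => [T T' TT'|c T T1 T2 TT].
  by apply: expand_ext => r; apply: (ks [::]).
by rewrite -expand_linl; apply: expand_ext => r; apply: (kl [::]).
Qed.

Lemma expand_linr k s1 a s2 : edgewise k ->
  linear (fun u => expand (s1 ++ (a, u) :: s2) k).
Proof.
elim: s1 k => [|[b v] s1 IH] k ke c u u' /=.
  exact/lift_is_linear/expand_respects.
by rewrite -lift_linl; congr lift; apply/funext => T; apply/IH/edgewise_cons.
Qed.

Lemma expand_linA k s1 u s2 : edgewise k ->
  linear (fun a => expand (s1 ++ (a, u) :: s2) k).
Proof.
elim: s1 k => [|[b v] s1 IH] k ke c a a' /=; rewrite -lift_linl; congr lift.
  apply/funext => T; rewrite -expand_linl; apply: expand_ext => r.
  exact: (edgewise_linA ke [::]).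
by apply/funext => T; apply/IH/edgewise_cons.
Qed.

Lemma expand_swap k s1 x y s2 :
    (forall r1 x y r2, k (r1 ++ [:: x, y & r2]) = k (r1 ++ [:: y, x & r2])) ->
  expand (s1 ++ [:: x, y & s2]) k = expand (s1 ++ [:: y, x & s2]) k.
Proof.
elim: s1 k => [|[b w] s1 IH] k ksym /=; last first.
  congr lift; apply/funext => T; apply: IH => r1 x' y' r2.
  exact: (ksym ((b, T) :: r1)).
case: x y => [a u] [b v] /=; rewrite lift_comm.
congr lift; apply/funext => T'; congr lift; apply/funext => T.
by apply: expand_ext => r; apply: (ksym [::]).
Qed.

Lemma expand_tcls k r : edgewise k ->
  expand [seq (e.1, tcls e.2) | e <- r] k = k r.
Proof.
elim: r k => [//|[a T] r IH] k ke /=.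
rewrite lift_gen; last exact: expand_respects.
exact/IH/edgewise_cons.
Qed.

End Expand.

Lemma Node_edgewise d : edgewise (fun r => tcls (Node d r)).
Proof.
split=> [r1 a T T' r2 TT'|r1 a c T T1 T2 r2 TT|r1 T r2 c a a'].
- exact/tcls_swap/swap_deep.
- exact/tcls_lin/lin_deep.
- exact/tcls_lin/lin_here.
Qed.

Lemma Bplus_tcls d r :
  Bplus d [seq (e.1, tcls e.2) | e <- r] = tcls (Node d r).
Proof. exact/expand_tcls/Node_edgewise. Qed.

Lemma Bplus_linr d s1 a s2 : linear (fun u => Bplus d (s1 ++ (a, u) :: s2)).
Proof. exact/expand_linr/Node_edgewise. Qed.

Lemma Bplus_linA d s1 u s2 : linear (fun a => Bplus d (s1 ++ (a, u) :: s2)).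
Proof. exact/expand_linA/Node_edgewise. Qed.

Lemma Bplus_swap d s1 x y s2 :
  Bplus d (s1 ++ [:: x, y & s2]) = Bplus d (s1 ++ [:: y, x & s2]).
Proof. by apply: expand_swap => *; apply/tcls_swap/swap_here. Qed.

Section Circ.
Variable Phi : {linear (A ⊗ A)%type -> (A ⊗ A)%type}.

(* One step of the recursion defining x o_a B_d(a1 T1, ..., ak Tk).  The i-th
   entry of s is (ai, (Ti, fun q => x o_q Ti)). *)
Definition graft_node (x : g) (a : A) (d : D)
    (s : seq (A * (g * (A -> g)))) : g :=
  let t := [seq (e.1, e.2.1) | e <- s] in
  Bplus d ((a, x) :: t) +
  \sum_(i < size s)
    let e := nth (0, (0, fun=> 0)) s i in
    sweedler Phi a e.1 (fun p q => Bplus d (set_nth (0, 0) t i (p, e.2.2 q))).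

Lemma addrDD (V : lmodType K) (c : K) (u u' v v' : V) :
  (c *: u + u') + (c *: v + v') = c *: (u + v) + (u' + v').
Proof. by rewrite scalerDr addrACA. Qed.

Section GraftNode.
Implicit Types (s : seq (A * (g * (A -> g)))) (k : seq (A * g) -> g).
Let under s := [seq (e.1, e.2.1) | e <- s].

Definition graft_sum a k s : g :=
  \sum_(i < size s)
    let e := nth (0, (0, fun=> 0)) s i in
    sweedler Phi a e.1 (fun p q => k (set_nth (0, 0) (under s) i (p, e.2.2 q))).

Lemma graft_nodeE x a d s :
  graft_node x a d s = Bplus d ((a, x) :: under s) + graft_sum a (Bplus d) s.
Proof. by []. Qed.

Lemma graft_sum_cat a k s1 s2 : graft_sum a k (s1 ++ s2) =
  graft_sum a (fun t => k (t ++ under s2)) s1 +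
  graft_sum a (fun t => k (under s1 ++ t)) s2.
Proof.
rewrite /graft_sum.
have ext m m' (em : m = m') (F : nat -> g) :
  \sum_(i < m) F i = \sum_(i < m') F i by rewrite em.
rewrite (ext _ _ (size_cat s1 s2) (fun i =>
  let e := nth (0, (0, fun=> 0)) (s1 ++ s2) i in
  sweedler Phi a e.1
    (fun p q => k (set_nth (0, 0) (under (s1 ++ s2)) i (p, e.2.2 q))))).
rewrite big_split_ord /=; congr (_ + _); apply: eq_bigr => i _ /=.
  rewrite nth_cat ltn_ord; congr sweedler; apply/funext => p; apply/funext => q.
  congr k; rewrite /under map_cat !set_nthE size_cat !size_map ltn_ord.
  rewrite (leq_trans (ltn_ord i) (leq_addr _ _)) -catA /=.
  rewrite take_cat drop_cat !size_map ltn_ord.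
  case: ltnP => // le1.
  have -> : i.+1 = size s1 by apply/eqP; rewrite eqn_leq ltn_ord.
  by rewrite subnn drop0 drop_oversize ?size_map.
rewrite nth_cat ltnNge leq_addr /= addKn.
congr sweedler; apply/funext => p; apply/funext => q; congr k.
rewrite /under map_cat !set_nthE size_cat !size_map ltn_ord ltn_add2l ltn_ord.
rewrite take_cat drop_cat !size_map ltnNge leq_addr /= addKn.
by rewrite ltnNge (leq_trans (leq_addr i _) (leqnSn _)) /= -addnS addKn catA.
Qed.

Lemma graft_sum1 a k e :
  graft_sum a k [:: e] = sweedler Phi a e.1 (fun p q => k [:: (p, e.2.2 q)]).
Proof. by rewrite /graft_sum big_ord1. Qed.

Lemma graft_sum_ext a k k' s : k =1 k' -> graft_sum a k s = graft_sum a k' s.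
Proof. by move=> kk'; have -> : k = k' by apply/funext. Qed.

Lemma graft_sum_linl a c k k' s :
  graft_sum a (fun t => c *: k t + k' t) s =
    c *: graft_sum a k s + graft_sum a k' s.
Proof.
rewrite /graft_sum scaler_sumr -big_split /=; apply: eq_bigr => i _.
exact: sweedler_linl.
Qed.

Lemma graft_sum_cons a k e s : graft_sum a k (e :: s) =
  sweedler Phi a e.1 (fun p q => k ((p, e.2.2 q) :: under s)) +
  graft_sum a (fun t => k ((e.1, e.2.1) :: t)) s.
Proof. by rewrite -cat1s graft_sum_cat graft_sum1. Qed.

Lemma graft_sum_cons3 a k s1 e s2 : graft_sum a k (s1 ++ e :: s2) =
  graft_sum a (fun t => k (t ++ (e.1, e.2.1) :: under s2)) s1 +
  (sweedler Phi a e.1 (fun p q => k (under s1 ++ (p, e.2.2 q) :: under s2)) +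
   graft_sum a (fun t => k (under s1 ++ (e.1, e.2.1) :: t)) s2).
Proof. by rewrite graft_sum_cat graft_sum_cons. Qed.

Lemma graft_node_swap x a d s1 e e' s2 :
  graft_node x a d (s1 ++ [:: e, e' & s2]) =
  graft_node x a d (s1 ++ [:: e', e & s2]).
Proof.
rewrite !graft_nodeE /under !map_cat /= -!cat_cons Bplus_swap; congr (_ + _).
rewrite !graft_sum_cat; congr (_ + _).
  by apply: graft_sum_ext => t; rewrite /under /= Bplus_swap.
rewrite !graft_sum_cons /= addrCA; congr (_ + (_ + _)).
- by congr sweedler; apply/funext => p; apply/funext => q; rewrite Bplus_swap.
- by congr sweedler; apply/funext => p; apply/funext => q; rewrite Bplus_swap.
- by apply: graft_sum_ext => t; rewrite Bplus_swap.
Qed.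

Lemma Bplus_bilinear d t1 t2 (f : A -> g) :
  linear f -> bilinear_fun (fun p q => Bplus d (t1 ++ (p, f q) :: t2)).
Proof.
move=> lf; split=> [q c p p'|p c q q']; first exact: Bplus_linA.
by rewrite lf Bplus_linr.
Qed.

Lemma graft_node_linu x a d s1 b c u u' f f' s2 :
  graft_node x a d (s1 ++ (b, (c *: u + u', fun q => c *: f q + f' q)) :: s2) =
    c *: graft_node x a d (s1 ++ (b, (u, f)) :: s2) +
    graft_node x a d (s1 ++ (b, (u', f')) :: s2).
Proof.
rewrite !graft_nodeE /under !map_cat /= -!cat_cons Bplus_linr -addrDD.
congr (_ + _); rewrite !graft_sum_cons3 /= -!addrDD; congr (_ + (_ + _)).
- by rewrite -graft_sum_linl; apply: graft_sum_ext => t; rewrite Bplus_linr.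
- rewrite -sweedler_linl; congr sweedler; apply/funext => p; apply/funext => q.
  by rewrite Bplus_linr.
- by rewrite -graft_sum_linl; apply: graft_sum_ext => t; rewrite Bplus_linr.
Qed.

Lemma graft_node_linb x a d s1 u f s2 : linear f ->
  linear (fun b => graft_node x a d (s1 ++ (b, (u, f)) :: s2)).
Proof.
move=> lf c b b'.
rewrite !graft_nodeE /under !map_cat /= -!cat_cons Bplus_linA -addrDD.
congr (_ + _); rewrite !graft_sum_cons3 /= -!addrDD; congr (_ + (_ + _)).
- by rewrite -graft_sum_linl; apply: graft_sum_ext => t; rewrite Bplus_linA.
- exact/sweedler_linb/Bplus_bilinear.
- by rewrite -graft_sum_linl; apply: graft_sum_ext => t; rewrite Bplus_linA.
Qed.

Lemma graft_node_lina x d s :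
    (forall i, (i < size s)%N -> linear (nth (0, (0, fun=> 0)) s i).2.2) ->
  linear (fun a => graft_node x a d s).
Proof.
move=> ls c a a'; rewrite !graft_nodeE -addrDD; congr (_ + _).
  exact: (Bplus_linA d [::]).
rewrite /graft_sum scaler_sumr -big_split /=; apply: eq_bigr => i _.
apply: sweedler_lina.
suff -> : (fun p q => Bplus d (set_nth (0, 0) (under s) i
    (p, (nth (0, (0, fun=> 0)) s i).2.2 q))) = (fun p q => Bplus d
    (take i (under s) ++ (p, (nth (0, (0, fun=> 0)) s i).2.2 q)
       :: drop i.+1 (under s))) by exact/Bplus_bilinear/ls.
apply/funext => p; apply/funext => q.
by rewrite set_nthE /under size_map ltn_ord.
Qed.

End GraftNode.

Fixpoint graft (x : g) (T : tree) (a : A) {struct T} : g :=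
  let: Node d s := T in
  graft_node x a d
    [seq (let: (b, T') := e in (b, (tcls T', graft x T'))) | e <- s].

Definition circ (a : A) (x y : g) : g := lift (fun T => graft x T a) y.


Lemma ptree_ind' (P : tree -> Prop) :
  (forall d s, (forall e, e \in s -> P e.2) -> P (Node d s)) -> forall T, P T.
Proof.
move=> PN; fix IH 1 => -[d s]; apply: PN; elim: s => [|[b T] s IHs] e.
  by clear IH; rewrite in_nil.
by rewrite inE => /orP[/eqP -> /=|]; [apply: IH|exact: IHs].
Qed.

Lemma graft_lina x T : linear (graft x T).
Proof.
elim/ptree_ind': T => d s IH /=; apply: graft_node_lina => i.
rewrite size_map => si; rewrite (nth_map (0, Node d [::])) //.
by have := IH _ (mem_nth (0, Node d [::]) si); case: (nth _ _ _).
Qed.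

Lemma graft_linx T a : linear (fun x => graft x T a).
Proof.
elim/ptree_ind': T a => d s IH a c x x' /=.
rewrite !graft_nodeE -addrDD -!map_comp.
have E y : [seq (e.1, e.2.1)
    | e <- [seq (let: (b, T') := e in (b, (tcls T', graft y T'))) | e <- s]] =
    [seq (e.1, tcls e.2) | e <- s].
  by rewrite -map_comp; apply: eq_map => -[].
have E' y : [seq ((fun e => (e.1, e.2.1)) \o
    (fun e => let: (b, T') := e in (b, (tcls T', graft y T')))) i | i <- s] =
    [seq (e.1, tcls e.2) | e <- s].
  by apply: eq_map => -[].
rewrite !E'; congr (_ + _); first exact: (Bplus_linr d [::]).
rewrite /graft_sum !E !size_map scaler_sumr -big_split /=.
apply: eq_bigr => i _; rewrite !(nth_map (0, Node d [::])) //.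
have := IH _ (mem_nth (0, Node d [::]) (ltn_ord i)).
case: (nth _ _ _) => b T' /= lT'; rewrite -sweedler_linl; congr sweedler.
apply/funext => p; apply/funext => q; rewrite lT' !set_nthE size_map ltn_ord.
by rewrite Bplus_linr.
Qed.

Lemma graft_swap x T T' : tree_swap T T' -> graft x T = graft x T'.
Proof.
elim=> [d s1 e e' s2|d s1 b U U' s2 UU' IH]; apply/funext => a /=.
  by rewrite !map_cat /=; case: e e' => [? ?] [? ?]; rewrite graft_node_swap.
by rewrite !map_cat /= IH (tcls_swap UU').
Qed.

Lemma graft_lin x c T T1 T2 : tree_lin c T T1 T2 ->
  graft x T = (fun a => c *: graft x T1 a + graft x T2 a).
Proof.
elim=> [d s1 b b' U s2|d s1 b U U1 U2 s2 UU IH]; apply/funext => a /=.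
  by rewrite !map_cat /=; apply/graft_node_linb/graft_lina.
by rewrite !map_cat /= IH (tcls_lin UU) graft_node_linu.
Qed.

Lemma graft_respects x a : respects tree_rel (fun T => graft x T a).
Proof.
by apply: tree_respects => [T T' /(graft_swap x) ->|c T T1 T2 /(graft_lin x) ->].
Qed.

Lemma circ_tcls a x T : circ a x (tcls T) = graft x T a.
Proof. exact/lift_gen/graft_respects. Qed.

Lemma circ_linr a x : linear (circ a x).
Proof. exact/lift_is_linear/graft_respects. Qed.

Lemma circ_lina x y : linear (fun a => circ a x y).
Proof.
move=> c a a'; rewrite /circ -lift_linl; congr lift; apply/funext => T.
exact: graft_lina.
Qed.

Lemma circ_linl a y : linear (fun x => circ a x y).
Proof.
move=> c x x'; rewrite /circ -lift_linl; congr lift; apply/funext => T.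
exact: graft_linx.
Qed.

Lemma circ_Bplus a x d (t : seq (A * g)) :
  circ a x (Bplus d t) = Bplus d ((a, x) :: t) +
    \sum_(i < size t)
      let e := nth (0, 0) t i in
      sweedler Phi a e.1
        (fun p q => Bplus d (set_nth (0, 0) t i (p, circ q x e.2))).
Proof.
pose up (t' : seq (A * g)) : seq (A * (g * (A -> g))) :=
  [seq (e.1, (e.2, fun q => circ q x e.2)) | e <- t'].
suff E r : circ a x (Bplus d ([seq (e.1, tcls e.2) | e <- r] ++ t)) =
    graft_node x a d (up ([seq (e.1, tcls e.2) | e <- r] ++ t)).
  have U : [seq (e.1, e.2.1) | e <- up t] = t.
    by rewrite -map_comp -[RHS]map_id; apply: eq_map => -[].
  have /= -> := E [::]; rewrite graft_nodeE /graft_sum U size_map.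
  by congr (_ + _); apply: eq_bigr => i _; rewrite (nth_map (0, 0)).
elim: t r => [|[b u] t IH] r.
  rewrite !cats0 Bplus_tcls circ_tcls /= /up -map_comp; congr graft_node.
  apply: eq_map => -[b T] /=; congr (_, (_, _)); apply/funext => q.
  by rewrite circ_tcls.
move: u; apply: presented_ext => [c u u'|c u u'|T].
- by rewrite Bplus_linr circ_linr.
- rewrite /up !map_cat /= -graft_node_linu; congr graft_node.
  by congr (_ ++ (_, (_, _)) :: _); apply/funext => q; rewrite circ_linr.
by have := IH (rcons r (b, T)); rewrite map_rcons cat_rcons.
Qed.

End Circ.

End Trees.

(* Main.v *)
(** Let [push a x] be the derivation of lists of typed subtrees that replaces
    one entry [(c, z)] by the Sweedler sum of the entries [(p, x o_q z)], where
    [Phi (a ⊗ c)] is the sum of the [p ⊗ q].  Then [x o_a B_d s] is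
    [B_d ((a, x) :: s)] plus [B_d] applied to [push a x s], so the prelie
    identity at [B_d s] says that [push b y] followed by [push a x], minus the
    Sweedler sum of the [push p (x o_q y)], is symmetric in [(a, x)] and
    [(b, y)].  On lists with at least two entries the mixed terms are
    symmetric, so everything reduces to a single entry, where the two lCEDS
    identities and the prelie identity at that smaller entry give the symmetry.

    Conversely, evaluate the prelie identity at a ladder [z] with two vertices,
    for [x] a single vertex and [y] a ladder with one edge of type [e <> 0].
    Linear forms on trees that read off the edge types of two shapes of trees
    recover the two lCEDS identities, the asymmetry between [x] and [y]
    replacing the second decoration that [D] may lack.

    For freeness, solving the recursion for [B_d ((a, x) :: s)] defines braces
    in any Phi-prelie algebra [W].  The same symmetry of [push] makes the braces
    symmetric, so that they define a map from trees to [W]. *)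

Require Import Defs.
From HB Require Import structures.
From mathcomp Require Import all_boot all_order all_algebra.
From mathcomp Require Import boolp classical_sets ssrAC.

Set Implicit Arguments.
Unset Strict Implicit.
Unset Printing Implicit Defensive.

Import GRing.Theory.
Local Open Scope ring_scope.

(** * Linear maps given as bare functions *)

Section LinearFunctions.
Variables (K : fieldType) (U V W : lmodType K).

Definition linear_map (f : U -> V) (lf : linear f) : {linear U -> V} :=
  HB.pack_for {linear U -> V} f (GRing.isLinear.Build K U V *:%R f lf).

Lemma linear_at0 (f : U -> V) : linear f -> f 0 = 0.
Proof. by move=> lf; exact: (linear0 (linear_map lf)). Qed.

Lemma linear_atD (f : U -> V) u v : linear f -> f (u + v) = f u + f v.
Proof. by move=> lf; exact: (linearD (linear_map lf)). Qed.

Lemma linear_atB (f : U -> V) u v : linear f -> f (u - v) = f u - f v.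
Proof. by move=> lf; exact: (linearB (linear_map lf)). Qed.

Lemma linear_comp (f : V -> W) (h : U -> V) :
  linear f -> linear h -> linear (fun u => f (h u)).
Proof. by move=> lf lh c u v; rewrite lh lf. Qed.

Lemma linear_scale (h : U -> V) c : linear h -> linear (fun u => c *: h u).
Proof. by move=> lh a u v; rewrite lh scalerDr !scalerA mulrC. Qed.

Lemma linear_scale_form (h : U -> K^o) (v : V) :
  linear h -> linear (fun u => h u *: v).
Proof. by move=> lh a u u'; rewrite lh scalerDl scalerA. Qed.

End LinearFunctions.

(** * Sweedler sums *)

Section Sweedler.
Variables (K : fieldType) (A : lmodType K).
Implicit Types (V W : lmodType K) (Phi : {linear (A ⊗ A)%type -> (A ⊗ A)%type}).

Local Transparent tlift.

(** For every [F] the lift is a finite sum over the support of a representative of [t], and [h]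
    passes through that sum. *)
Lemma tlift_comp (U1 U2 : lmodType K) V W (h : V -> W) (F : U1 -> U2 -> V)
    (t : (U1 ⊗ U2)%type) :
  linear h -> h (tlift F t) = tlift (fun u v => h (F u v)) t.
Proof.
move=> lh; have -> : h = linear_map lh by [].
rewrite /tlift /Defs.lift /mlift raddf_sum; apply: eq_bigr => k _.
exact: (linearZ_LR (linear_map lh)).
Qed.

Lemma sweedlerC V Phi a b c d (F : A -> A -> A -> A -> V) :
  sweedler Phi a b (fun p q => sweedler Phi c d (F p q)) =
  sweedler Phi c d (fun r s => sweedler Phi a b (fun p q => F p q r s)).
Proof. exact: lift_comm. Qed.

Local Opaque tlift.

Section Fixed.
Variable Phi : {linear (A ⊗ A)%type -> (A ⊗ A)%type}.
Local Notation sw := (sweedler Phi).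

Lemma eq_sweedler V a b (F F' : A -> A -> V) :
  (forall p q, F p q = F' p q) -> sw a b F = sw a b F'.
Proof. exact: tlift_ext. Qed.

Lemma linear_sweedler V W (h : V -> W) a b F :
  linear h -> h (sw a b F) = sw a b (fun p q => h (F p q)).
Proof. exact: tlift_comp. Qed.

Lemma sweedlerD V a b (F F' : A -> A -> V) :
  sw a b (fun p q => F p q + F' p q) = sw a b F + sw a b F'.
Proof.
rewrite -[sw a b F]scale1r -sweedler_linl.
by apply: eq_sweedler => p q; rewrite scale1r.
Qed.

Lemma sweedlerB V a b (F F' : A -> A -> V) :
  sw a b (fun p q => F p q - F' p q) = sw a b F - sw a b F'.
Proof.
rewrite addrC -scaleN1r -sweedler_linl.
by apply: eq_sweedler => p q; rewrite scaleN1r addrC.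
Qed.

Lemma sweedler0 V a b : sw a b (fun _ _ => 0 : V) = 0.
Proof. by rewrite -[RHS](subrr (sw a b (fun _ _ => 0))) -sweedlerB subr0. Qed.

Lemma sweedler_eq0 V a b (F : A -> A -> V) :
  (forall p q, F p q = 0) -> sw a b F = 0.
Proof. by move=> F0; rewrite -[RHS](sweedler0 V a b); exact: eq_sweedler. Qed.

(** The lift of the universal bilinear map is the identity of [A ⊗ A]. *)
Lemma sweedler_tens V a b (h : (A ⊗ A)%type -> V) :
  linear h -> sw a b (fun p q => h (p ⊗ q)) = h (Phi (a ⊗ b)).
Proof.
move=> lh; rewrite -(linear_sweedler a b (fun p q => p ⊗ q) lh); congr h.
rewrite /sweedler; move: (Phi _).
apply: (@tensor_ext K A A _ (tlift (fun p q => p ⊗ q)) id) => //.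
  exact/tlift_is_linear/tens_bilinear.
by move=> v w; rewrite tlift_tens //; apply: tens_bilinear.
Qed.

End Fixed.

(** * Trilinear maps and triple tensors *)

Definition trilinear (U1 U2 U3 : lmodType K) V (G : U1 -> U2 -> U3 -> V) :
    Prop :=
  [/\ forall v w, linear (fun u => G u v w),
      forall u w, linear (fun v => G u v w) &
      forall u v, linear (fun w => G u v w)].

Lemma tens_linl (U1 U2 : lmodType K) (v : U2) : linear (fun u : U1 => u ⊗ v).
Proof. exact: (tens_bilinear U1 U2).1. Qed.

Lemma tens_linr (U1 U2 : lmodType K) (u : U1) : linear (fun v : U2 => u ⊗ v).
Proof. exact: (tens_bilinear U1 U2).2. Qed.

Lemma tens3_trilinear : trilinear (fun u v w : A => (u ⊗ v) ⊗ w).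
Proof.
split=> u v /=; last exact: tens_linr.
  by apply: (linear_comp (@tens_linl _ _ v)) => c ? ?; rewrite tens_linl.
by apply: (linear_comp (@tens_linl _ _ v)) => c ? ?; rewrite tens_linr.
Qed.

Lemma tens3_lift V (G : A -> A -> A -> V) : trilinear G ->
  exists2 h : ((A ⊗ A) ⊗ A)%type -> V,
    linear h & forall u v w, h ((u ⊗ v) ⊗ w) = G u v w.
Proof.
move=> [G1 G2 G3]; pose H t w := tlift (fun u v => G u v w) t.
have Gb w : bilinear_fun (fun u v => G u v w) by split.
have Hb : bilinear_fun H.
  split=> [w|t c w w']; first exact: tlift_is_linear.
  by rewrite /H -tlift_linl; apply: tlift_ext => u v; rewrite G3.
exists (tlift H) => [|u v w]; first exact: tlift_is_linear.
by rewrite tlift_tens // /H tlift_tens.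
Qed.

Lemma tens3_ext V (f f' : ((A ⊗ A) ⊗ A)%type -> V) : linear f -> linear f' ->
  (forall u v w, f ((u ⊗ v) ⊗ w) = f' ((u ⊗ v) ⊗ w)) -> f =1 f'.
Proof.
move=> lf lf' ff'; apply: tensor_ext => // t w; move: t.
apply: (@tensor_ext K A A V (fun t => f (t ⊗ w)) (fun t => f' (t ⊗ w))) => //.
  exact/linear_comp/tens_linl.
exact/linear_comp/tens_linl.
Qed.

Section OnTriples.
Variable f : {linear (A ⊗ A)%type -> (A ⊗ A)%type}.

Lemma tens_id_linear : linear (tens_id f).
Proof.
apply: tlift_is_linear; split=> [w|v]; last exact: tens_linr.
by apply: (linear_comp (@tens_linl _ _ w)); exact: linearP.
Qed.

Lemma assoc_linear (U1 U2 U3 : lmodType K) : linear (@assoc K U1 U2 U3).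
Proof.
apply: tlift_is_linear; split=> [w|t c w w'] /=.
  apply: tlift_is_linear; split=> [v|u]; first exact: tens_linl.
  by apply: (linear_comp (@tens_linr _ _ u)); exact: tens_linl.
rewrite -tlift_linl; apply: tlift_ext => u v.
by rewrite tens_linr tens_linr.
Qed.

Lemma assoc_inv_linear (U1 U2 U3 : lmodType K) : linear (@assoc_inv K U1 U2 U3).
Proof.
apply: tlift_is_linear; split=> [t c u u'|u] /=.
  rewrite -tlift_linl; apply: tlift_ext => v w.
  by rewrite tens_linl tens_linl.
apply: tlift_is_linear; split=> [w|v]; last exact: tens_linr.
by apply: (linear_comp (@tens_linl _ _ w)); exact: tens_linr.
Qed.

Lemma id_tens_linear : linear (id_tens f).
Proof.
apply: (linear_comp (@assoc_inv_linear A A A)).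
apply: (linear_comp (f := tmap id f)); last exact: assoc_linear.
apply: tlift_is_linear; split=> [w|v]; first exact: tens_linl.
by apply: (linear_comp (@tens_linr _ _ v)); exact: linearP.
Qed.

Lemma tens_id_tens u v w : tens_id f ((u ⊗ v) ⊗ w) = f (u ⊗ v) ⊗ w.
Proof. exact: (tmap_tens f (GRing.Linear.clone K A A _ idfun _)). Qed.

Lemma id_tens_tens u v w : id_tens f ((u ⊗ v) ⊗ w) = assoc_inv (u ⊗ f (v ⊗ w)).
Proof.
rewrite /id_tens /= assoc_tens; congr assoc_inv.
exact: (tmap_tens (GRing.Linear.clone K A A _ idfun _) f).
Qed.

End OnTriples.
End Sweedler.

(** * The lCEDS axioms as identities between Sweedler sums *)

Section LCEDS.
Variables (K : fieldType) (A : lmodType K).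
Variable Phi : {linear (A ⊗ A)%type -> (A ⊗ A)%type}.
Local Notation sw := (sweedler Phi).
Local Notation A3 := ((A ⊗ A) ⊗ A)%type.

(* The two lCEDS axioms in Sweedler notation.  The second is the given one with
   its factors permuted: for L := (Phi ⊗ Id) o (Id ⊗ Phi), it says that
   L o (tau ⊗ Id) = (Id ⊗ tau) o L. *)
Definition lCEDS_assoc (V : lmodType K) (G : A -> A -> A -> V) : Prop :=
  forall a b c,
  sw b c (fun p q => sw a p (fun p' q' => sw q' q (fun r s => G p' r s))) =
  sw a b (fun p q => sw p c (fun p' q' => G p' q' q)).

Definition lCEDS_comm (V : lmodType K) (G : A -> A -> A -> V) : Prop :=
  forall a b c,
  sw b c (fun p q => sw a p (fun p' q' => G p' q' q)) =
  sw a c (fun p q => sw b p (fun p' q' => G p' q q')).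

Lemma flip_linear (V W : lmodType K) : linear (@flip K V W).
Proof.
by apply: tlift_is_linear; split=> [w|v]; [exact: tens_linr|exact: tens_linl].
Qed.

Section Apply.
Variables (V : lmodType K) (h : A3 -> V).
Hypothesis lh : linear h.

Lemma apply_tens_id u v w :
  h (tens_id Phi ((u ⊗ v) ⊗ w)) = sw u v (fun p q => h ((p ⊗ q) ⊗ w)).
Proof.
rewrite tens_id_tens (sweedler_tens Phi u v (h := fun t => h (t ⊗ w))) //.
exact/linear_comp/tens_linl.
Qed.

Lemma apply_id_tens u v w :
  h (id_tens Phi ((u ⊗ v) ⊗ w)) = sw v w (fun p q => h ((u ⊗ p) ⊗ q)).
Proof.
rewrite id_tens_tens.
rewrite -(sweedler_tens Phi v w (h := fun t => h (assoc_inv (u ⊗ t)))).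
  by apply: eq_sweedler => p q; rewrite assoc_inv_tens.
apply: (linear_comp lh); apply: (linear_comp (@assoc_inv_linear _ _ _ _)).
exact: tens_linr.
Qed.
End Apply.

Lemma tens_id_flip (u v w : A) :
  tens_id (@flip K A A) ((u ⊗ v) ⊗ w) = (v ⊗ u) ⊗ w.
Proof.
by rewrite (tens_id_tens (linear_map (@flip_linear A A))) /= flip_tens.
Qed.

Lemma id_tens_flip (u v w : A) :
  id_tens (@flip K A A) ((u ⊗ v) ⊗ w) = (u ⊗ w) ⊗ v.
Proof.
rewrite (id_tens_tens (linear_map (@flip_linear A A))) /= flip_tens.
exact: assoc_inv_tens.
Qed.

Let ltau1 : linear (tens_id (@flip K A A)) :=
  tens_id_linear (linear_map (@flip_linear A A)).
Let ltau2 : linear (id_tens (@flip K A A)) :=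
  id_tens_linear (linear_map (@flip_linear A A)).
Let lPhi1 := tens_id_linear Phi.
Let lPhi2 := id_tens_linear Phi.

Lemma lCEDS_sweedler : lCEDS Phi ->
  forall (V : lmodType K) (G : A -> A -> A -> V), trilinear G ->
  lCEDS_assoc G /\ lCEDS_comm G.
Proof.
move=> [e1 e2] V G trG; split=> a b c.
  have [h lh hG] := tens3_lift trG.
  have := congr1 h (e1 ((a ⊗ b) ⊗ c)) => /=.
  rewrite (apply_id_tens
    (h := fun t => h (id_tens Phi (tens_id Phi t)))); last first.
    exact/(linear_comp lh)/(linear_comp lPhi2).
  rewrite (apply_tens_id
    (h := fun t => h (tens_id Phi (id_tens _ t)))); last first.
    exact/(linear_comp lh)/(linear_comp lPhi1).
  move=> E; apply: etrans (etrans E _); apply: eq_sweedler => p q.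
    rewrite (apply_tens_id (h := fun t => h (id_tens Phi t))); last first.
      exact: (linear_comp lh lPhi2).
    apply: eq_sweedler => p' q'; rewrite (apply_id_tens lh).
    by apply: eq_sweedler => r s; rewrite hG.
  rewrite id_tens_flip (apply_tens_id lh).
  by apply: eq_sweedler => p' q'; rewrite hG.
(* At [b ⊗ c ⊗ a] the left side of the second axiom is a sum of [q ⊗ p' ⊗ q'], so the arguments of
   [G] are rotated before lifting. *)
have [G1 G2 G3] := trG; have /tens3_lift[h lh hG] :
    trilinear (fun u v w => G v w u).
  by split=> *; [exact: G3|exact: G1|exact: G2].
have := congr1 h (e2 ((b ⊗ c) ⊗ a)) => /=.
rewrite id_tens_flip (apply_id_tens
  (h := fun t => h (tens_id (@flip K A A) (tens_id Phi t)))); last first.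
  exact/(linear_comp lh)/(linear_comp ltau1).
rewrite (apply_tens_id (h := fun t =>
  h (id_tens Phi (id_tens (@flip K A A) (tens_id (@flip K A A) t)))));
  last first.
  exact/(linear_comp lh)/(linear_comp lPhi2)/(linear_comp ltau2).
move=> E; apply: etrans (etrans E _); apply: eq_sweedler => p q.
  rewrite tens_id_flip id_tens_flip (apply_id_tens lh).
  by apply: eq_sweedler => p' q'; rewrite hG.
rewrite (apply_tens_id (h := fun t => h (tens_id (@flip K A A) t))); last first.
  exact: (linear_comp lh ltau1).
by apply: eq_sweedler => p' q'; rewrite tens_id_flip hG.
Qed.

(** Both choices of [G] are the universal trilinear map up to rotation, and linear maps on triple
    tensors are equal once they agree on pure tensors. *)
Lemma sweedler_lCEDS :
  lCEDS_assoc (fun u v w : A => (u ⊗ v) ⊗ w) ->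
  lCEDS_comm (fun u v w : A => (w ⊗ u) ⊗ v) -> lCEDS Phi.
Proof.
move=> e1 e2; split.
  apply: tens3_ext => [||a b c] /=.
  - exact/(linear_comp lPhi2)/(linear_comp lPhi1).
  - exact/(linear_comp lPhi1)/(linear_comp ltau2).
  rewrite (apply_id_tens
    (h := fun t => id_tens Phi (tens_id Phi t))); last first.
    exact: (linear_comp lPhi2 lPhi1).
  rewrite (apply_tens_id (h := fun t => tens_id Phi (id_tens _ t))); last first.
    exact: (linear_comp lPhi1 ltau2).
  apply: etrans (etrans (e1 a b c) _); apply: eq_sweedler => p q.
    rewrite (apply_tens_id lPhi2); apply: eq_sweedler => p' q'.
    by rewrite (apply_id_tens (h := id)).
  by rewrite id_tens_flip (apply_tens_id (h := id)).
apply: tens3_ext => [||a b c] /=.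
- exact/(linear_comp lPhi2)/(linear_comp ltau2)/(linear_comp ltau1).
- exact/(linear_comp ltau1)/(linear_comp lPhi1)/(linear_comp lPhi2).
rewrite id_tens_flip (apply_tens_id (h := fun t =>
  id_tens Phi (id_tens (@flip K A A) (tens_id (@flip K A A) t)))); last first.
  exact/(linear_comp lPhi2)/(linear_comp ltau2).
rewrite (apply_id_tens
  (h := fun t => tens_id (@flip K A A) (tens_id Phi t))); last first.
  exact: (linear_comp ltau1).
apply: etrans (etrans (e2 c a b) _); apply: eq_sweedler => p q.
  by rewrite tens_id_flip id_tens_flip (apply_id_tens (h := id)).
rewrite (apply_tens_id ltau1); apply: eq_sweedler => p' q'.
by rewrite tens_id_flip.
Qed.
End LCEDS.

(** * Derivations of lists *)

Section Multilinear.
Variables (K : fieldType) (A W V : lmodType K).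
Implicit Types (k : seq (A * W) -> V) (s : seq (A * W)).

(* The length is fixed because the brace of a list is known to be multilinear
   only after the braces of shorter lists are. *)
Record multilinear n k : Prop := Multilinear {
  multilinear_type s1 x s2 : (size s1 + size s2).+1 = n ->
    linear (fun a => k (s1 ++ (a, x) :: s2));
  multilinear_arg s1 a s2 : (size s1 + size s2).+1 = n ->
    linear (fun x => k (s1 ++ (a, x) :: s2))
}.

Lemma multilinear_cons n k e :
  multilinear n.+1 k -> multilinear n (fun s => k (e :: s)).
Proof.
move=> [kA kW]; split=> s1 y s2 sn.
  by apply: (kA (e :: s1)); rewrite -sn.
by apply: (kW (e :: s1)); rewrite -sn.
Qed.

Lemma multilinear_head k s : multilinear (size s).+1 k ->
  bilinear_fun (fun p w => k ((p, w) :: s)).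
Proof.
by move=> [kA kW]; split=> y; [exact: (kA [::])|exact: (kW [::])].
Qed.

(** Adjacent transpositions generate all permutations; fixing the length lets [brace_swap_invariant]
    proceed by induction on it. *)
Definition swap_invariant n k : Prop := forall s1 e e' s2,
  (size s1 + size s2).+2 = n ->
  k (s1 ++ [:: e, e' & s2]) = k (s1 ++ [:: e', e & s2]).

Lemma swap_invariant_cons n k e :
  swap_invariant n.+1 k -> swap_invariant n (fun s => k (e :: s)).
Proof. by move=> ks s1 u v s2 sn; apply: (ks (e :: s1)); rewrite -sn. Qed.

End Multilinear.

Section Push.
Variables (K : fieldType) (A : lmodType K).
Variable Phi : {linear (A ⊗ A)%type -> (A ⊗ A)%type}.
Variables (W : lmodType K) (op : A -> W -> W -> W).
Implicit Types (V : lmodType K) (s : seq (A * W)).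
Local Notation sw := (sweedler Phi).

(* The continuation [k] stands for the rest of the tree, so that a Sweedler sum
   in the middle of a list needs no formal sums of lists. *)
Fixpoint push V (a : A) (x : W) (k : seq (A * W) -> V) s : V :=
  if s is (c, z) :: s' then
    sw a c (fun p q => k ((p, op q x z) :: s')) +
    push a x (fun t => k ((c, z) :: t)) s'
  else 0.

(** [push] preserves length, so agreement on lists of that length is enough. This lets [brace_cons]
    absorb the counter of [brace_rec]. *)
Lemma eq_push V a x (k k' : seq (A * W) -> V) s :
  (forall t, size t = size s -> k t = k' t) -> push a x k s = push a x k' s.
Proof.
elim: s k k' => [//|[c z] s IH] k k' kk' /=; congr (_ + _).
  by apply: eq_sweedler => p q; apply: kk'.
by apply: IH => t ts; apply: kk'; rewrite /= ts.
Qed.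

Lemma push_linl V a x c (k k' : seq (A * W) -> V) s :
  push a x (fun t => c *: k t + k' t) s = c *: push a x k s + push a x k' s.
Proof.
elim: s k k' => [|[b z] s IH] k k' /=; first by rewrite scaler0 addr0.
by rewrite IH sweedler_linl addrDD.
Qed.

Lemma pushD V a x (k k' : seq (A * W) -> V) s :
  push a x (fun t => k t + k' t) s = push a x k s + push a x k' s.
Proof.
rewrite -[push a x k s]scale1r -push_linl.
by apply: eq_push => t _; rewrite scale1r.
Qed.

Lemma pushB V a x (k k' : seq (A * W) -> V) s :
  push a x (fun t => k t - k' t) s = push a x k s - push a x k' s.
Proof.
rewrite addrC -scaleN1r -push_linl.
by apply: eq_push => t _; rewrite scaleN1r addrC.
Qed.

Lemma linear_push V V' (h : V -> V') a x k s :
  linear h -> h (push a x k s) = push a x (fun t => h (k t)) s.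
Proof.
move=> lh; elim: s k => [|[c z] s IH] k /=; first exact: linear_at0.
by rewrite linear_atD // IH linear_sweedler.
Qed.

Lemma push_sweedler V a x b c (k : A -> A -> seq (A * W) -> V) s :
  push a x (fun t => sw b c (fun p q => k p q t)) s =
  sw b c (fun p q => push a x (k p q) s).
Proof.
elim: s k => [|[d z] s IH] k /=; first by rewrite sweedler0.
by rewrite sweedlerD IH sweedlerC.
Qed.

Hypothesis op_linA : forall x y, linear (fun a => op a x y).
Hypothesis op_linl : forall a y, linear (fun x => op a x y).
Hypothesis op_linr : forall a x, linear (op a x).

Lemma bilinear_head_op V (k : seq (A * W) -> V) x z s :
  multilinear (size s).+1 k ->
  bilinear_fun (fun p q => k ((p, op q x z) :: s)).
Proof.
move=> /multilinear_head[kA kW]; split=> [q|p]; first exact: kA.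
exact: (linear_comp (kW p)).
Qed.

Lemma push_lina V x (k : seq (A * W) -> V) s :
  multilinear (size s) k -> linear (fun a => push a x k s).
Proof.
elim: s k => [|[c z] s IH] k km b a a' /=; first by rewrite scaler0 addr0.
rewrite IH; last exact: multilinear_cons.
by rewrite (sweedler_lina _ _ (bilinear_head_op x z km)) addrDD.
Qed.

Lemma push_linx V a (k : seq (A * W) -> V) s :
  multilinear (size s) k -> linear (fun x => push a x k s).
Proof.
elim: s k => [|[c z] s IH] k km b x x' /=; first by rewrite scaler0 addr0.
rewrite IH; last exact: multilinear_cons.
have [_ kW] := multilinear_head km.
rewrite -addrDD -sweedler_linl; congr (_ + _); apply: eq_sweedler => p q.
by rewrite op_linl kW.
Qed.

Lemma push_multilinear V a x n (k : seq (A * W) -> V) :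
  multilinear n k -> multilinear n (push a x k).
Proof.
move=> km; split=> s1 y s2 sn; 
  elim: s1 n k km sn => [|[c z] s1 IH] n k km /= sn;
  move: km; rewrite -sn => km b u u' /=.
(* Four cases: a type at the head, a type further on, an argument at the head, an argument further
   on. *)
- rewrite (sweedler_linb _ _ (bilinear_head_op x y km)).
  rewrite -addrDD -push_linl; congr (_ + _); apply: eq_push => t ts.
  by rewrite -ts in km; rewrite (multilinear_head km).1.
- rewrite (IH _ _ (multilinear_cons _ km)) //.
  rewrite -addrDD -sweedler_linl; congr (_ + _); apply: eq_sweedler => p q.
  by rewrite (multilinear_type km (s1 := (p, op q x z) :: s1)).
- have [_ kW] := multilinear_head km.
  rewrite -addrDD -push_linl -sweedler_linl; congr (_ + _).
    by apply: eq_sweedler => p q; rewrite op_linr kW.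
  by apply: eq_push => t ts; rewrite -ts in km; rewrite (multilinear_head km).2.
- rewrite (IH _ _ (multilinear_cons _ km)) //.
  rewrite -addrDD -sweedler_linl; congr (_ + _); apply: eq_sweedler => p q.
  by rewrite (multilinear_arg km (s1 := (p, op q x z) :: s1)).
Qed.

Lemma push_swap_invariant V a x n (k : seq (A * W) -> V) :
  swap_invariant n k -> swap_invariant n (push a x k).
Proof.
move=> ks s1 e e' s2; elim: s1 n k ks => [|[c z] s1 IH] n k ks /= sn;
  move: ks; rewrite -sn => ks.
  (* With the pair at the head, the two Sweedler sums that alter it trade places. *)
  case: e e' => [c z] [c' z'] /=; rewrite addrCA; congr (_ + (_ + _)).
  - by apply: eq_sweedler => p q; apply: (ks [::]).
  - by apply: eq_sweedler => p q; apply: (ks [::]).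
  - by apply: eq_push => t ts; apply: (ks [::]); rewrite /= ts.
congr (_ + _); last exact/(IH (size s1 + size s2).+2)/erefl/swap_invariant_cons.
by apply: eq_sweedler => p q; apply: (ks (_ :: s1)).
Qed.

(** * Symmetry of the defect of two pushes *)

Section Defect.
Variable V : lmodType K.
Implicit Types k : seq (A * W) -> V.

(** Continuations act last: the list is hit first by [y] and then by [x], as in
    [x o_a (y o_b z)]. *)
Definition push_defect a x b y k s : V :=
  push b y (push a x k) s - sw a b (fun p q => push p (op q x y) k s).

(** The third argument is fixed because induction on trees supplies the identity at subtrees. *)
Definition prelie_at z : Prop := forall a b x y,
  op a x (op b y z) - sw a b (fun p q => op p (op q x y) z) =
  op b y (op a x z) - sw b a (fun p q => op p (op q y x) z).

(** The part of [push_defect] in which [x] and [y] both act on the one entry [(c, z)]; [G] reads the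
    resulting entry. *)
Definition local_defect a x b y (G : A -> W -> V) c z : V :=
  sw b c (fun p q => sw a p (fun p' q' => G p' (op q' x (op q y z)))) -
  sw a b (fun p q => sw p c (fun p' q' => G p' (op q' (op q x y) z))).

(** The prelie identity at [z] splits the first sum in three. By [lCEDS_assoc] the sum with [x o y]
    cancels the subtracted one. [lCEDS_comm] exchanges [a] and [b] in the other two, and
    [lCEDS_assoc] brings the one with [y o x] to the form subtracted on the right. *)
Lemma local_defect_sym a x b y G c z : lCEDS Phi -> bilinear_fun G ->
  prelie_at z -> local_defect a x b y G c z = local_defect b y a x G c z.
Proof.
move=> /lCEDS_sweedler cA [GA GW] pz; rewrite /local_defect.
have G_sw p a1 a2 F : G p (sw a1 a2 F) = sw a1 a2 (fun q r => G p (F q r)).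
  exact: linear_sweedler.
have tri u v : trilinear (fun p q r => G p (op q (op r u v) z)).
  split=> p q.
  - exact: GA.
  - exact: (linear_comp (GW p)).
  - exact/(linear_comp (GW p))/(linear_comp (op_linl _ _)).
have [triA _] := cA _ _ (tri x y).
have [triA' _] := cA _ _ (tri y x).
have tri2 : trilinear (fun p' q' q => G p' (op q y (op q' x z))).
  split=> p q.
  - exact: GA.
  - exact/(linear_comp (GW p))/(linear_comp (op_linr _ _)).
  - exact: (linear_comp (GW p)).
have bil p : bilinear_fun (fun r t => G p (op r (op t y x) z)).
  by case: (tri y x) => _ t2 t3; split=> q; [exact: t2|exact: t3].
have tri3 : trilinear (fun p' q' q =>
    sw q q' (fun r t => G p' (op r (op t y x) z))).
  split=> p q.
  - move=> c' a1 a2; rewrite -sweedler_linl; apply: eq_sweedler => r t.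
    exact: GA.
  - exact: sweedler_linb.
  - exact: sweedler_lina.
have [_ comm2] := cA _ _ tri2; have [_ comm3] := cA _ _ tri3.
(* The prelie identity at [z] with parameters [q'] and [q], under both Sweedler sums. *)
have -> : sw b c (fun p q => sw a p (fun p' q' => G p' (op q' x (op q y z)))) =
    sw b c (fun p q => sw a p (fun p' q' => G p' (op q y (op q' x z)))) +
    sw b c (fun p q => sw a p (fun p' q' =>
      sw q' q (fun r t => G p' (op r (op t x y) z)))) -
    sw b c (fun p q => sw a p (fun p' q' =>
      sw q q' (fun r t => G p' (op r (op t y x) z)))).
  rewrite -sweedlerD -sweedlerB; apply: eq_sweedler => p q.
  rewrite -sweedlerD -sweedlerB; apply: eq_sweedler => p' q'.
  rewrite -!G_sw -linear_atD // -linear_atB //; congr G.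
  by rewrite addrAC -pz subrK.
by rewrite triA comm2 comm3 triA' addrAC addrK.
Qed.

Lemma push_defect_sym a x b y k s : lCEDS Phi -> multilinear (size s) k ->
    (forall e, e \in s -> prelie_at e.2) ->
  push_defect a x b y k s = push_defect b y a x k s.
Proof.
move=> cA; rewrite /push_defect; elim: s k => [|[c z] s IH] k km ps /=.
  by rewrite !sweedler0.
have := local_defect_sym a x b y c cA (multilinear_head km)
  (ps _ (mem_head _ _)).
have := IH _ (multilinear_cons (c, z) km)
  (fun e es => ps e (@mem_behead _ ((c, z) :: s) e es)).
rewrite /local_defect !pushD !sweedlerD !push_sweedler /=.
(* [P - Q] is the defect at the head and [D - T] that of the tail; [R] and [S] are the mixed terms,
   where one push hits the head and the other the tail. *)
have regroup (P Q R S D T : V) :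
  P + R + (S + D) - (Q + T) = (P - Q) + (D - T) + (R + S).
  by rewrite opprD [LHS](AC (2*2*2) ((1*5)*(4*6)*(2*3))).
by move=> eqD eqP; rewrite !regroup eqD eqP; congr (_ + _); rewrite addrC.
Qed.
End Defect.
End Push.

(** * The prelie identity on trees *)

Section TypedTrees.
Variables (K : fieldType) (A : lmodType K) (D : Type).
Variable Phi : {linear (A ⊗ A)%type -> (A ⊗ A)%type}.
Local Notation g := (typed_trees A D).
Local Notation sw := (sweedler Phi).
Local Notation gpush := (push Phi (@circ K A D Phi)).

Lemma Bplus_multilinear d n : multilinear n (@Bplus K A D d).
Proof. by split=> s1 y s2 _; [exact: Bplus_linA|exact: Bplus_linr]. Qed.

Lemma pushE (V : lmodType K) (W : lmodType K) (op : A -> W -> W -> W) a x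
    (k : seq (A * W) -> V) (t : seq (A * W)) :
  push Phi op a x k t =
  \sum_(i < size t) let e := nth (0, 0) t i in
    sw a e.1 (fun p q => k (set_nth (0, 0) t i (p, op q x e.2))).
Proof.
elim: t k => [|[c z] t IH] k /=; first by rewrite big_ord0.
by rewrite big_ord_recl IH.
Qed.

Lemma circ_Bplus_push a x d t :
  circ Phi a x (Bplus d t) = Bplus d ((a, x) :: t) + gpush a x (Bplus d) t.
Proof. by rewrite circ_Bplus pushE. Qed.

Let lA := circ_lina (D := D) Phi.
Let lL := circ_linl (D := D) Phi.
Let lR := circ_linr (D := D) Phi.

Lemma circ_circ_Bplus a b x y d t :
  circ Phi a x (circ Phi b y (Bplus d t)) -
    sw a b (fun p q => circ Phi p (circ Phi q x y) (Bplus d t)) =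
  Bplus d [:: (a, x), (b, y) & t] +
  (gpush a x (fun s => Bplus d ((b, y) :: s)) t +
   gpush b y (fun s => Bplus d ((a, x) :: s)) t) +
  push_defect Phi (@circ K A D Phi) a x b y (Bplus d) t.
Proof.
rewrite circ_Bplus_push linear_atD // (linear_push _ _ _ _ _ _ (lR a x)).
rewrite circ_Bplus_push /=.
rewrite (@eq_push _ _ _ _ _ _ b y _ _ _
  (fun s _ => circ_Bplus_push a x d s)) pushD.
have -> : sw a b (fun p q => circ Phi p (circ Phi q x y) (Bplus d t)) =
    sw a b (fun p q => Bplus d ((p, circ Phi q x y) :: t)) +
    sw a b (fun p q => gpush p (circ Phi q x y) (Bplus d) t).
  by rewrite -sweedlerD; apply: eq_sweedler => p q; rewrite circ_Bplus_push.
(* Term 2, from pushing [x] onto the new entry [(b, y)], cancels term 6, the root grafting of the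
   correction. *)
rewrite /push_defect opprD [LHS](AC (1*2*2*2) ((1*(3*4)*(5*7))*(2*6))).
by rewrite /= subrr addr0.
Qed.

(** The terms of [circ_circ_Bplus] outside the defect are symmetric, the first one by
    [Bplus_swap]. *)
Lemma prelie_Bplus a b x y d t :
  (circ Phi a x (circ Phi b y (Bplus d t)) -
     sw a b (fun p q => circ Phi p (circ Phi q x y) (Bplus d t)) =
   circ Phi b y (circ Phi a x (Bplus d t)) -
     sw b a (fun p q => circ Phi p (circ Phi q y x) (Bplus d t))) <->
  push_defect Phi (@circ K A D Phi) a x b y (Bplus d) t =
  push_defect Phi (@circ K A D Phi) b y a x (Bplus d) t.
Proof.
rewrite !circ_circ_Bplus (Bplus_swap d [::]) /=.
move: (gpush a x _ t) (gpush b y _ t) (Bplus d _) => u v w.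
rewrite (addrC v u); move: (push_defect _ _ _ _ _ _ _ _) => r.
by split=> [/addrI|->].
Qed.

(** By linearity [z] may be a tree, that is, [B_d] of its subtrees; the induction hypothesis is then
    the premise of [push_defect_sym]. *)
Lemma circ_prelie_at : lCEDS Phi -> forall z, prelie_at Phi (@circ K A D Phi) z.
Proof.
move=> cA z a b x y; move: z.
have lin a' b' (x' y' : g) : linear (fun z =>
    circ Phi a' x' (circ Phi b' y' z) -
    sw a' b' (fun p q => circ Phi p (circ Phi q x' y') z)).
  move=> c u v; rewrite !lR scalerBr addrACA -opprD; congr (_ - _).
  by rewrite -sweedler_linl; apply: eq_sweedler => p q; rewrite lR.
apply: presented_ext => [||T]; [exact: lin|exact: lin|].
elim/ptree_ind': T a b x y => d s IH a b x y.
rewrite -/(tcls (Node d s)) -Bplus_tcls; apply/prelie_Bplus.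
apply: (push_defect_sym lA lL lR a x b y cA (@Bplus_multilinear d _)) => e.
by case/mapP => e' es -> a' b' x' y'; apply: IH.
Qed.

Lemma circ_phi_prelie : lCEDS Phi -> phi_prelie Phi (@circ K A D Phi).
Proof. move=> cA; split=> [|||a b x y z].
- exact: lA.
- exact: lL.
- exact: lR.
- exact: circ_prelie_at.
 Qed.

End TypedTrees.

(** * Freeness *)

Section Brace.
Variables (K : fieldType) (A : lmodType K).
Variable Phi : {linear (A ⊗ A)%type -> (A ⊗ A)%type}.
Variables (W : lmodType K) (op : A -> W -> W -> W).
Hypothesis opP : phi_prelie Phi op.
Implicit Types s : seq (A * W).

Let lA := prelie_linA opP.
Let lL := prelie_linl opP.
Let lR := prelie_linr opP.

(* [brace w [:: (a1, w1); ...; (ak, wk)]] is the image of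
   [B_d(a1 T1, ..., ak Tk)] when [Ti] is sent to [wi] and the vertex decorated
   by [d] to [w].  The recursion is on the length [n] because [push] evaluates
   braces of lists that are not sublists of the given one. *)
Fixpoint brace_rec n w s : W :=
  if n is n'.+1 then
    if s is (a, x) :: s' then
      op a x (brace_rec n' w s') - push Phi op a x (brace_rec n' w) s'
    else w
  else w.

Definition brace w s : W := brace_rec (size s) w s.

Lemma brace_cons w a x s :
  brace w ((a, x) :: s) = op a x (brace w s) - push Phi op a x (brace w) s.
Proof.
by rewrite {1}/brace /=; congr (_ - _); apply: eq_push => t <-.
Qed.

Lemma brace_multilinear w n : multilinear n (brace w).
Proof.
elim: n => [|n IH]; first by split.
split=> [[|[c z] s1] y s2 /= [sn]|[|[c z] s1] b s2 /= [sn]] c' u v.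
- rewrite !brace_cons lA push_lina //; last by rewrite -sn in IH.
  by rewrite scalerBr opprD addrACA.
- rewrite !brace_cons (multilinear_type IH) //.
  rewrite (multilinear_type (push_multilinear Phi lA lR c z IH)) //.
  by rewrite lR scalerBr opprD addrACA.
- rewrite !brace_cons lL push_linx //; last by rewrite -sn in IH.
  by rewrite scalerBr opprD addrACA.
- rewrite !brace_cons (multilinear_arg IH) //.
  rewrite (multilinear_arg (push_multilinear Phi lA lR c z IH)) //.
  by rewrite lR scalerBr opprD addrACA.
Qed.

Lemma brace_swap_invariant w n : lCEDS Phi -> swap_invariant n (brace w).
Proof.
move=> cA; elim: n => [//|n IH] [|[c z] s1] e e' s2 /= [sn]; last first.
  by rewrite !brace_cons IH // (push_swap_invariant Phi op c z IH).
case: e e' => [a x] [b y] /=; rewrite !brace_cons /=.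
have expand_op a' x' b' y' :
    op a' x' (op b' y' (brace w s2) - push Phi op b' y' (brace w) s2) =
    op a' x' (op b' y' (brace w s2)) -
    push Phi op b' y' (fun t => op a' x' (brace w t)) s2.
  by rewrite linear_atB // (linear_push _ _ _ _ _ _ (lR _ _)).
have expand_push a' x' b' y' :
    push Phi op a' x' (fun t => brace w ((b', y') :: t)) s2 =
    push Phi op a' x' (fun t => op b' y' (brace w t)) s2 -
    push Phi op a' x' (push Phi op b' y' (brace w)) s2.
  by rewrite -pushB; apply: eq_push => t _; rewrite brace_cons.
have expand_sw a' x' b' y' :
    sweedler Phi a' b' (fun p q => brace w ((p, op q x' y') :: s2)) =
    sweedler Phi a' b' (fun p q => op p (op q x' y') (brace w s2)) -
    sweedler Phi a' b' (fun p q => push Phi op p (op q x' y') (brace w) s2).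
  by rewrite -sweedlerB; apply: eq_sweedler => p q; rewrite brace_cons.
rewrite !expand_op !expand_push !expand_sw.
have := push_defect_sym lA lL lR a x b y cA (brace_multilinear w (size s2))
  (fun e _ a' b' x' y' => prelieE opP a' b' x' y' e.2).
have := prelieE opP a b x y (brace w s2); rewrite /push_defect.
(* [X - Z] is a side of the prelie identity, [Y] and [U] are exchanged by the swap, and [R + T] is
   invariant by the symmetry of the defect with its terms moved across. *)
have regroup (X Y Z T U R : W) : X - Y - (Z - T + (U - R)) =
  (X - Z) + (- (Y + U)) + (R + T).
  by rewrite !opprD !opprK [LHS](AC (2*(2*2)) ((1*3)*(2*5)*(6*4))).
rewrite !regroup => -> eqD; congr (_ + - _ + _); first by rewrite addrC.
by apply/eqP; rewrite -subr_eq addrAC -eqD subrK.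
Qed.

End Brace.

Section Free.
Variables (K : fieldType) (A : lmodType K) (D : Type).
Variable Phi : {linear (A ⊗ A)%type -> (A ⊗ A)%type}.
Local Notation g := (typed_trees A D).

Lemma lift_tcls (V : lmodType K) (h : g -> V) :
  linear h -> Defs.lift (fun T => h (tcls T)) =1 h.
Proof.
move=> lh.
have resp : respects (@tree_rel K A D) (fun T => h (tcls T)).
  apply: tree_respects => [T T' /tcls_swap->//|c T T1 T2 /tcls_lin->].
  exact: lh.
apply: presented_ext; [exact: lift_is_linear|exact: lh|] => T.
exact: lift_gen.
Qed.

Lemma linear_expand (V V' : lmodType K) (h : V -> V') (s : seq (A * g)) k :
  linear h -> h (expand s k) = expand s (fun r => h (k r)).
Proof.
move=> lh; elim: s k => [//|[a u] s IH] k /=.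
rewrite -[LHS]/(linear_map lh _) /Defs.lift /mlift raddf_sum.
apply: eq_bigr => T _; rewrite -IH; exact: (linearZ_LR (linear_map lh)).
Qed.

(** Entries are folded back one at a time: extending a linear map from the classes of trees gives
    that map again. *)
Lemma expand_map (V W : lmodType K) (h : g -> W) (k : seq (A * W) -> V) s :
    linear h -> (forall n, multilinear n k) ->
  expand s (fun r => k [seq (e.1, h (tcls e.2)) | e <- r]) =
  k [seq (e.1, h e.2) | e <- s].
Proof.
move=> lh; elim: s k => [//|[a u] s IH] k km /=.
have km' T n : multilinear n (fun t => k ((a, h (tcls T)) :: t)).
  exact: multilinear_cons.
have lk : linear (fun v => k ((a, h v) :: [seq (e.1, h e.2) | e <- s])).
  have [_ kW] := multilinear_head (km (size [seq (e.1, h e.2) | e <- s]).+1).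
  exact: (linear_comp (kW a)).
rewrite -(lift_tcls lk); congr Defs.lift; apply/funext => T.
exact: (IH _ (km' T)).
Qed.

(** Compatibility is asked at the entries of [s] alone, so that an induction hypothesis on subtrees
    can provide it. *)
Lemma push_map (V W W' : lmodType K) (op : A -> W -> W -> W)
    (op' : A -> W' -> W' -> W') (h : W -> W') a x (k : seq (A * W') -> V)
    (s : seq (A * W)) :
    (forall q e, e \in s -> h (op q x e.2) = op' q (h x) (h e.2)) ->
  push Phi op a x (fun t => k [seq (e.1, h e.2) | e <- t]) s =
  push Phi op' a (h x) k [seq (e.1, h e.2) | e <- s].
Proof.
elim: s k => [//|[c z] s IH] k hop /=; congr (_ + _).
  by apply: eq_sweedler => p q; rewrite (hop q (c, z)) ?mem_head.
apply: (IH (fun t => k ((c, h z) :: t))) => q e es.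
by apply: hop; rewrite inE es orbT.
Qed.

Section Extension.
Variables (W : lmodType K) (op : A -> W -> W -> W) (f : D -> W).
Hypotheses (cA : lCEDS Phi) (opP : phi_prelie Phi op).
Local Notation br := (brace Phi op).

Fixpoint tree_eval (T : ptree A D) : W :=
  let: Node d s := T in
  br (f d) [seq (let: (a, T') := e in (a, tree_eval T')) | e <- s].

Lemma tree_eval_respects : respects (@tree_rel K A D) tree_eval.
Proof.
apply: tree_respects.
  move=> T T'; elim=> [d s1 e e' s2|d s1 a U U' s2 _ IH] /=;
    rewrite !map_cat /=.
    exact: (brace_swap_invariant opP (f d) cA _ _ (erefl _)).
  by rewrite IH.
move=> c T T1 T2; elim=> [d s1 a1 a2 U s2|d s1 a U U1 U2 s2 _ IH] /=.
  rewrite !map_cat /=.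
  by rewrite (multilinear_type (brace_multilinear opP (f d) _) _ (erefl _)).
rewrite !map_cat /= IH.
by rewrite (multilinear_arg (brace_multilinear opP (f d) _) _ (erefl _)).
Qed.

Lemma tree_eval_extension :
  exists h : {linear g -> W}, forall T, h (tcls T) = tree_eval T.
Proof.
exists (linear_map (lift_is_linear tree_eval_respects)) => T.
exact/lift_gen/tree_eval_respects.
Qed.

Section Eval.
Variable h : {linear g -> W}.
Hypothesis hE : forall T, h (tcls T) = tree_eval T.

Lemma eval_Bplus d s : h (Bplus d s) = br (f d) [seq (e.1, h e.2) | e <- s].
Proof.
rewrite /Bplus (linear_expand (h := h)); last exact: linearP.
rewrite -(expand_map s (h := h)); last 2 first.
- exact: linearP.
- exact: brace_multilinear.
apply: expand_ext => r; rewrite hE /=; congr brace.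
by apply: eq_map => -[a T] /=; rewrite hE.
Qed.

(** By [brace_cons] the image of [B_d ((a, x) :: s)] is the wanted product minus a [push], and the
    induction hypothesis at the subtrees identifies that [push] with the image of the remaining
    term. *)
Lemma eval_circ a x y : h (circ Phi a x y) = op a (h x) (h y).
Proof.
move: y; apply: presented_ext => [c u v|c u v|T].
- by rewrite circ_linr linearP.
- by rewrite linearP (prelie_linr opP).
rewrite -/(tcls T); elim/ptree_ind': T a x => d s IH a x.
rewrite -Bplus_tcls circ_Bplus_push linearD !eval_Bplus /= brace_cons.
rewrite (linear_push _ _ _ _ _ _ (h := h)); last exact: linearP.
rewrite (@eq_push _ _ _ _ _ _ _ _ _ _ _ (fun t _ => eval_Bplus d t)).
rewrite (push_map (op' := op)) ?subrK // => q e /mapP[e' es ->]; exact: IH.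
Qed.

End Eval.

(** The recursion determines [B_d ((a, x) :: s)] from [B_d] of lists as long as [s] but with new
    entries, hence an induction on the length. *)
Lemma extension_Bplus (h : {linear g -> W}) d s :
    (forall d, h (@vertex K A D d) = f d) ->
    (forall a x y, h (circ Phi a x y) = op a (h x) (h y)) ->
  h (Bplus d s) = br (f d) [seq (e.1, h e.2) | e <- s].
Proof.
move=> hf hop; move: {2}(size s) (leqnn (size s)) => n.
elim: n s => [|n IH] [|[a x] s] //= sn; try exact: hf.
have := congr1 h (circ_Bplus_push Phi a x d s).
rewrite linearD hop IH // (linear_push _ _ _ _ _ _ (h := h));
  last exact: linearP.
rewrite (@eq_push _ _ _ _ _ _ _ _
  (fun t => h (Bplus d t)) (fun t => br (f d) [seq (e.1, h e.2) | e <- t])).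
  rewrite (push_map (op' := op)) => [/eqP|q e _]; last exact: hop.
  by rewrite -subr_eq brace_cons => /eqP.
by move=> t ts; apply: IH; rewrite ts.
Qed.

Lemma extension_unique (h h' : {linear g -> W}) :
    (forall d, h (@vertex K A D d) = f d) ->
    (forall a x y, h (circ Phi a x y) = op a (h x) (h y)) ->
    (forall d, h' (@vertex K A D d) = f d) ->
    (forall a x y, h' (circ Phi a x y) = op a (h' x) (h' y)) ->
  h =1 h'.
Proof.
move=> hf hop hf' hop'; apply: presented_ext => [c u v|c u v|T].
- by rewrite linearP.
- by rewrite linearP.
rewrite -/(tcls T); elim/ptree_ind': T => d s IH.
rewrite -!Bplus_tcls !extension_Bplus // -!map_comp; congr brace.
by apply/eq_in_map => e es; congr (_, _); exact: IH.
Qed.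

End Extension.

Lemma typed_trees_free : lCEDS Phi ->
  free_phi_prelie Phi (@circ K A D Phi) (@vertex K A D).
Proof.
move=> cA; split; first exact: circ_phi_prelie.
move=> W op opP f extends; have [h hE] := tree_eval_extension f cA opP.
have hop := eval_circ opP hE.
exists h => [|h' [hf' hop']]; first by split=> // d; exact: hE.
by apply: (extension_unique hf' hop') => // d; exact: hE.
Qed.

End Free.

(** * Necessity of the lCEDS axioms *)

(** Zorn gives a maximal subspace avoiding [e]; [phi] is the coefficient of [e] modulo it. *)
Lemma linear_form_through (K : fieldType) (A : lmodType K) (e : A) : e != 0 ->
  exists2 phi : A -> K^o, linear phi & phi e = 1.
Proof.
move=> e0; pose closed (H : set A) :=
  (forall c u v, H u -> H v -> H (c *: u + v)) /\ ~ H e.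
have [|H [[HZD He] Hmax]] := @Zorn_bigcup A closed.
  move=> F Fc Ftot; split=> [c u v [X FX Xu] [Y FY Yv]|[X FX Xe]].
    have [XY|YX] := Ftot _ _ FX FY.
      by exists Y => //; apply: (Fc _ FY).1 => //; exact: XY.
    by exists X => //; apply: (Fc _ FX).1 => //; exact: YX.
  exact: (Fc _ FX).2.
(* [closed] does not ask for 0, so that the empty union of an empty chain satisfies it; [L] adjoins
   0. *)
pose L v := H v \/ v = 0.
have LZD c u v : L u -> L v -> L (c *: u + v).
  move=> [Hu|->] [Hv|->]; rewrite ?scaler0 ?add0r ?addr0.
  - by left; apply: HZD.
  - by left; rewrite -[c](subrK 1) scalerDl scale1r; apply: HZD.
  - by left.
  - by right.
have LZ c u : L u -> L (c *: u).
  by move=> Lu; rewrite -[_ *: _]addr0; apply: LZD => //; right.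
have Le : ~ L e by move=> [/He|/eqP]; [|rewrite (negbTE e0)].
have decomp v : exists c, L (v - c *: e).
  have [Lv|nLv] := pselect (L v); first by exists 0; rewrite scale0r subr0.
  (* [B] is [L] plus the line of [v]. If it avoids [e], maximality is contradicted; otherwise
     [e - c *: v] lies in [L] with [c] invertible. *)
  pose B u := exists c, L (u - c *: v).
  have [BH|] := pselect (closed B); last first.
    move=> nclosed; have [c Lc] : B e.
      apply: contrapT => nBe; apply: nclosed; split=> // c u w [cu Lu] [cw Lw].
      exists (c * cu + cw); rewrite scalerDl -scalerA opprD addrACA -scalerBr.
      exact: LZD.
    have c0 : c != 0.
      by apply/eqP => c0; apply: Le; move: Lc; rewrite c0 scale0r subr0.
    exists c^-1; have := LZ (- c^-1) _ Lc; rewrite scalerBr !scaleNr opprK.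
    by rewrite scalerA mulVf // scale1r addrC.
  case: (Hmax B) => //; split=> [u Hu|BH'].
    by exists 0; rewrite scale0r subr0; left.
  by apply: nLv; left; apply: BH'; exists 1; rewrite scale1r subrr; right.
have uniq v c c' : L (v - c *: e) -> L (v - c' *: e) -> c = c'.
  move=> Lc Lc'; apply: contrapT => /eqP cc'; apply: Le.
  have cc0 : c' - c != 0 by rewrite subr_eq0 eq_sym.
  have := LZ (c' - c)^-1 _ (LZD (-1) _ _ Lc' Lc).
  rewrite scaleN1r opprB addrA subrK -scalerBl scalerA mulVf //.
  by rewrite scale1r.
have [phi phiP] := choice decomp.
exists phi => [c u v|].
  apply: (uniq (c *: u + v)); first exact: phiP.
  rewrite scalerDl -scalerA opprD addrACA -scalerBr.
  by apply: LZD; exact: phiP.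
by apply: (uniq e); [exact: phiP|rewrite scale1r subrr; right].
Qed.

(** * Linear maps that read the children of the root *)

Section RootForms.
Variables (K : fieldType) (A : lmodType K) (D : Type).
Local Notation g := (typed_trees A D).

(** The decoration of the root is forgotten, so a [root_form] is recovered from its lift by
    precomposing with any [B_d]. *)
Definition root_lift (V : lmodType K) (k : seq (A * g) -> V) : g -> V :=
  Defs.lift (fun T : ptree A D =>
    let: Node _ s := T in k [seq (e.1, tcls e.2) | e <- s]).

Definition root_form (V : lmodType K) (k : seq (A * g) -> V) : Prop :=
  forall n, multilinear n k /\ swap_invariant n k.

Section RootLift.
Variables (V : lmodType K) (k : seq (A * g) -> V).
Hypothesis kP : root_form k.

Let km n := (kP n).1.
Let ks n := (kP n).2.

Lemma root_lift_respects : respects (@tree_rel K A D) (fun T : ptree A D =>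
  let: Node _ s := T in k [seq (e.1, tcls e.2) | e <- s]).
Proof.
apply: tree_respects.
  move=> _ _ [d s1 e e' s2|d s1 a U U' s2 /tcls_swap UU']; rewrite !map_cat /=.
    exact: (ks _ _ (erefl _)).
  by rewrite UU'.
move=> c _ _ _ [d s1 a1 a2 U s2|d s1 a U U1 U2 s2 /tcls_lin UU];
  rewrite !map_cat /=.
  by rewrite (multilinear_type (km _) _ (erefl _)).
by rewrite UU (multilinear_arg (km _) _ (erefl _)).
Qed.

Lemma root_lift_linear : linear (root_lift k).
Proof. exact/lift_is_linear/root_lift_respects. Qed.

Lemma root_lift_Bplus d s : root_lift k (Bplus d s) = k s.
Proof.
rewrite /Bplus (linear_expand _ _ root_lift_linear).
transitivity (expand s (fun r => k [seq (e.1, id (tcls e.2)) | e <- r])).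
  by apply: expand_ext => r; exact: (lift_gen (Node d r) root_lift_respects).
rewrite (expand_map (h := id)) //; congr k.
by rewrite -[RHS]map_id; apply: eq_map => -[].
Qed.

End RootLift.

Lemma root_lift_linl (V : lmodType K) c (k k' : seq (A * g) -> V) u :
  root_lift (fun s => c *: k s + k' s) u = c *: root_lift k u + root_lift k' u.
Proof.
rewrite /root_lift -lift_linl; congr Defs.lift; apply/funext => -[]//.
Qed.

Definition no_child (s : seq (A * g)) : K^o := if s is [::] then 1 else 0.

Definition one_child (V : lmodType K) (F : A -> g -> V) (s : seq (A * g)) : V :=
  if s is [:: (a, u)] then F a u else 0.

(** Summing over both orders makes the value independent of the planar representative. *)
Definition two_children (V : lmodType K) (F : A -> g -> A -> g -> V)
    (s : seq (A * g)) : V :=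
  if s is [:: (a, u); (b, v)] then F a u b v + F b v a u else 0.

Lemma no_child_form : root_form no_child.
Proof.
have zero s1 e s2 : no_child (s1 ++ e :: s2) = 0 by case: s1.
move=> n; split; last by move=> s1 e e' s2 _; rewrite !zero.
by split=> s1 y s2 _ c u v; rewrite !zero scaler0 addr0.
Qed.

Lemma one_child_form (V : lmodType K) (F : A -> g -> V) :
  bilinear_fun F -> root_form (one_child F).
Proof.
move=> [FA Fg] n; split; last first.
  by move=> [|[a u] s1] [b v] [b' v'] s2 _ //=; case: s1 => [|[? ?] []].
split=> -[|[a' u'] [|[? ?] s1]] y [|[b' v'] s2] _ c u v /=;
  rewrite ?scaler0 ?addr0 //; [exact: FA|exact: Fg].
Qed.

Lemma two_children_form (V : lmodType K) (F : A -> g -> A -> g -> V) :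
    (forall b v, bilinear_fun (fun a u => F a u b v)) ->
    (forall a u, bilinear_fun (fun b v => F a u b v)) ->
  root_form (two_children F).
Proof.
move=> F1 F2 n; split; last first.
  move=> [|[a u] s1] [b v] [b' v'] s2 _ /=.
    by case: s2 => [|? ?] //; rewrite addrC.
  by case: s1 => [|[? ?] []].
split=> -[|[a u] [|[a' u'] s1]] y s2 _ c t t' /=.
- case: s2 => [|[b v] [|[? ?] ?]]; rewrite ?scaler0 ?addr0 //.
  by rewrite (F1 _ _).1 (F2 _ _).1 addrDD.
- case: s2 => [|[b v] s2]; rewrite ?scaler0 ?addr0 //.
  by rewrite (F1 _ _).1 (F2 _ _).1 addrDD.
- by case: s1 => [|[? ?] ?]; rewrite scaler0 addr0.
- case: s2 => [|[b v] [|[? ?] ?]]; rewrite ?scaler0 ?addr0 //.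
  by rewrite (F1 _ _).2 (F2 _ _).2 addrDD.
- case: s2 => [|[b v] s2]; rewrite ?scaler0 ?addr0 //.
  by rewrite (F1 _ _).2 (F2 _ _).2 addrDD.
- by case: s1 => [|[? ?] ?]; rewrite scaler0 addr0.
Qed.

End RootForms.

Section LocalDefect.
Variables (K : fieldType) (A : lmodType K).
Variable Phi : {linear (A ⊗ A)%type -> (A ⊗ A)%type}.
Variables (W : lmodType K) (op : A -> W -> W -> W).

Lemma linear_local_defect (V V' : lmodType K) (h : V -> V') a x b y
    (G : A -> W -> V) c z : linear h ->
  h (local_defect Phi op a x b y G c z) =
  local_defect Phi op a x b y (fun p w => h (G p w)) c z.
Proof.
move=> lh; rewrite /local_defect (linear_atB _ _ lh).
rewrite !(linear_sweedler _ _ _ _ lh).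
by congr (_ - _); apply: eq_sweedler => p q; exact: linear_sweedler.
Qed.

Lemma push_defect1 (V : lmodType K) a x b y (k : seq (A * W) -> V) c z :
  push_defect Phi op a x b y k [:: (c, z)] =
  local_defect Phi op a x b y (fun p w => k [:: (p, w)]) c z.
Proof.
rewrite /push_defect /local_defect /= addr0.
by congr (_ - _); apply: eq_sweedler => p q; rewrite addr0.
Qed.

End LocalDefect.

(** * Test trees and test maps that recover the two axioms *)

Section Necessity.
Variables (K : fieldType) (A : lmodType K) (D : Type).
Variable Phi : {linear (A ⊗ A)%type -> (A ⊗ A)%type}.
Local Notation g := (typed_trees A D).
Local Notation sw := (sweedler Phi).
Local Notation cr := (@circ K A D Phi).
Variable d : D.
Local Notation "•" := (Bplus d [::] : g).

Lemma circ_vertex a x : cr a x • = Bplus d [:: (a, x)].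
Proof. by rewrite circ_Bplus_push addr0. Qed.

Lemma circ_circ_vertex a x b y : cr a x (cr b y •) =
  Bplus d [:: (a, x); (b, y)] + sw a b (fun p q => Bplus d [:: (p, cr q x y)]).
Proof. by rewrite circ_vertex circ_Bplus_push /= addr0. Qed.

Hypothesis prelie_circ : phi_prelie Phi cr.

(** At the ladder [B_d [:: (c, •)]] the prelie identity is the symmetry of a defect on a single
    entry; a form on trees with one child at the root then turns [B_d [:: (p, w)]] into [H p w]. *)
Lemma local_defect_vertex (V : lmodType K) (H : A -> g -> V) a x b y c :
  bilinear_fun H ->
  local_defect Phi cr a x b y H c • = local_defect Phi cr b y a x H c •.
Proof.
move=> Hb; have kP := one_child_form Hb.
have eH : (fun p w => root_lift (one_child H) (Bplus d [:: (p, w)])) = H.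
  by apply/funext => p; apply/funext => w; rewrite root_lift_Bplus.
have hE a1 x1 b1 y1 :
    root_lift (one_child H)
      (push_defect Phi cr a1 x1 b1 y1 (Bplus d) [:: (c, •)]) =
    local_defect Phi cr a1 x1 b1 y1 H c •.
  rewrite push_defect1 -[in RHS]eH.
  exact/linear_local_defect/root_lift_linear.
apply: etrans (esym (hE a x b y)) (etrans _ (hE b y a x)).
by have /prelie_Bplus-> := prelieE prelie_circ a b x y (Bplus d [:: (c, •)]).
Qed.

Variables (e : A) (phi : A -> K^o).
Hypotheses (lphi : linear phi) (phi_e : phi e = 1) (two_neq0 : 2%:R != 0 :> K).

Let x : g := •.
Let y : g := Bplus d [:: (e, •)].

(** Equal to 1 on single vertices and 0 on other trees; together with [stem] it separates [x] from
    [y]. *)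
Let leaf : g -> K^o := root_lift (@no_child K A D).

Let leaf_linear : linear leaf.
Proof. exact/root_lift_linear/no_child_form. Qed.

Let leafE s : leaf (Bplus d s) = no_child s.
Proof. exact/root_lift_Bplus/no_child_form. Qed.

Let stem_kernel (a : A) (u : g) : K^o := phi a *: leaf u.

Let stem_bilinear : bilinear_fun stem_kernel.
Proof. by split=> *; [exact: linear_scale_form|exact: linear_scale]. Qed.

(** Equal to [phi a] on a ladder with two vertices and edge type [a], and 0 on other trees. *)
Let stem : g -> K^o := root_lift (one_child stem_kernel).

Let stem_linear : linear stem.
Proof. exact/root_lift_linear/one_child_form. Qed.

Let stemE s : stem (Bplus d s) = one_child stem_kernel s.
Proof. exact/root_lift_Bplus/one_child_form. Qed.

(** [H] sees two children at the root, so it kills every term that grafts [x] and [y] onto each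
    other; what survives is the corolla-like tree carrying both. *)
Lemma comm_of_prelie (V : lmodType K) (G : A -> A -> A -> V) :
  trilinear G -> lCEDS_comm Phi G.
Proof.
move=> [G1 G2 G3] a b c.
(* Keeps [G p q r] when [u] is [x] and [v] is [y], and vanishes when they are exchanged. *)
pose F p q u r v := leaf u *: (stem v *: G p q r).
have FP q u r v : linear (fun p => F p q u r v).
  exact/linear_scale/linear_scale.
have F1 p r v : bilinear_fun (fun q u => F p q u r v).
  split=> [u|q].
    exact/linear_scale/linear_scale.
  exact: linear_scale_form.
have F2 p q u : bilinear_fun (fun r v => F p q u r v).
  split=> [v|r].
    exact/linear_scale/linear_scale.
  exact/linear_scale/linear_scale_form.
have Fform p : root_form (two_children (F p)) by exact: two_children_form.
pose H p w := root_lift (two_children (F p)) w.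
have HE p s : H p (Bplus d s) = two_children (F p) s by exact: root_lift_Bplus.
have Hb : bilinear_fun H.
  split=> [w k p p'|p]; last exact: root_lift_linear.
  rewrite /H -root_lift_linl; congr root_lift.
  apply/funext => -[|[q u] [|[r v] [|? ?]]] /=;
    rewrite ?scaler0 ?addr0 //.
  by rewrite !FP addrDD.
have two_cell p a1 x1 a2 x2 : H p (cr a1 x1 (cr a2 x2 •)) =
    F p a1 x1 a2 x2 + F p a2 x2 a1 x1.
  rewrite circ_circ_vertex linear_atD ?HE; last exact: Hb.2.
  rewrite (linear_sweedler _ _ _ _ (Hb.2 p)).
  by rewrite sweedler_eq0 ?addr0 // => r s; exact: HE.
have defectE a1 x1 b1 y1 : local_defect Phi cr a1 x1 b1 y1 H c • =
    sw b1 c (fun p q => sw a1 p (fun p' q' =>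
      F p' q' x1 q y1 + F p' q y1 q' x1)).
  rewrite /local_defect -[RHS]subr0; congr (_ - _).
    by apply: eq_sweedler => p q; apply: eq_sweedler => p' q'; exact: two_cell.
  apply: sweedler_eq0 => p q; apply: sweedler_eq0 => p' q'.
  by rewrite circ_vertex; exact: HE.
have leafx : leaf x = 1 by rewrite leafE.
have leafy : leaf y = 0 by rewrite leafE.
have stemx : stem x = 0 by rewrite stemE.
have stemy : stem y = 1 by rewrite stemE /= /stem_kernel phi_e leafE scale1r.
have E := etrans (esym (defectE a x b y))
  (etrans (local_defect_vertex a x b y c Hb) (defectE b y a x)).
apply: etrans (etrans E _); apply: eq_sweedler => p q;
  apply: eq_sweedler => p' q'; rewrite /F leafx leafy stemx stemy.
  by rewrite !scale1r !scale0r addr0.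
by rewrite !scale1r !scale0r add0r.
Qed.

Let theta_kernel (a : A) (u : g) (b : A) (v : g) : A :=
  leaf u *: (leaf v *: (phi b *: a)).

Let theta : g -> A := root_lift (two_children theta_kernel).

Let theta_form : root_form (two_children theta_kernel).
Proof.
apply: two_children_form => a u; split=> b.
- exact/linear_scale/linear_scale/linear_scale.
- exact/linear_scale_form.
- exact/linear_scale/linear_scale/linear_scale_form.
- exact/linear_scale/linear_scale_form.
Qed.

Let thetaE s : theta (Bplus d s) = two_children theta_kernel s.
Proof. exact: root_lift_Bplus. Qed.

(* [theta] sends the corolla with edge types [s] and [e] to [s + phi s *: e];
   the correction term inverts this map, which is where 2 must be invertible. *)
Let branch (u : g) : A := theta u - (phi (theta u) / 2%:R) *: e.

Let branch_linear : linear branch.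
Proof.
have ltheta : linear theta by exact: root_lift_linear.
move=> c u v; rewrite /branch ltheta lphi scalerBr addrACA -opprD.
congr (_ - _); rewrite scalerA -scalerDl; congr (_ *: _).
by rewrite mulrDl mulrA.
Qed.

(** [H] sees one child at the root, and [branch] sends [x o_q y] to [q] and [y o_q x] to 0. One side
    of the symmetry becomes the difference of the two members of [lCEDS_assoc], the other
    vanishes. *)
Lemma assoc_of_prelie (V : lmodType K) (G : A -> A -> A -> V) :
  trilinear G -> lCEDS_assoc Phi G.
Proof.
move=> [G1 G2 G3] a b c.
have Fb p : bilinear_fun (fun r u => G p r (branch u)).
  by split=> [u|r]; [exact: G2|exact: (linear_comp (G3 p r))].
pose H p w := root_lift (one_child (fun r u => G p r (branch u))) w.
have HE p s : H p (Bplus d s) = one_child (fun r u => G p r (branch u)) s.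
  exact/root_lift_Bplus/one_child_form.
have Hb : bilinear_fun H.
  split=> [w k p p'|p]; last exact/root_lift_linear/one_child_form.
  rewrite /H -root_lift_linl; congr root_lift.
  apply/funext => -[|[r u] [|? ?]] /=;
    by rewrite ?scaler0 ?addr0 // G1.
have two_cell p a1 x1 a2 x2 : H p (cr a1 x1 (cr a2 x2 •)) =
    sw a1 a2 (fun r s => G p r (branch (cr s x1 x2))).
  rewrite circ_circ_vertex linear_atD ?HE ?add0r; last exact: Hb.2.
  rewrite (linear_sweedler _ _ _ _ (Hb.2 p)).
  by apply: eq_sweedler => r s; exact: HE.
have one_cell p a1 x1 : H p (cr a1 x1 •) = G p a1 (branch x1).
  by rewrite circ_vertex HE.
have leafx : leaf x = 1 by rewrite leafE.
have leafy : leaf y = 0 by rewrite leafE.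
(* Grafting [x] at the root of [y] gives the corolla with edge types [q] and [e]; grafting it at the
   leaf leaves one child at the root, which [theta] kills. *)
have branchxy q : branch (cr q x y) = q.
  have thetaxy : theta (cr q x y) = q + phi q *: e.
    have ltheta : linear theta by exact: root_lift_linear.
    rewrite /y circ_Bplus_push /= addr0 (linear_atD _ _ ltheta) thetaE.
    rewrite (linear_sweedler _ _ _ _ ltheta) sweedler_eq0 ?addr0; last first.
      by move=> r s; rewrite thetaE.
    by rewrite /= /theta_kernel leafx !scale1r phi_e scale1r.
  have phi_theta : phi (q + phi q *: e) = phi q *: 1 + phi q.
    by rewrite addrC lphi phi_e.
  rewrite /branch thetaxy phi_theta.
  rewrite -addrA -scalerBl.
  suff -> : phi q - (phi q *: 1 + phi q) / 2%:R = 0 by rewrite scale0r addr0.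
  rewrite -[phi q *: 1]/(phi q * 1) mulr1 -mulr2n -[_ *+ 2]mulr_natr mulfK //.
  exact: subrr.
have branchyx q : branch (cr q y x) = 0.
  have -> : cr q y x = Bplus d [:: (q, y)] by exact: circ_vertex.
  have theta0 : theta (Bplus d [:: (q, y)]) = 0 by rewrite thetaE.
  by rewrite /branch theta0 (linear_at0 lphi) mul0r scale0r subrr.
have defectE a1 x1 b1 y1 : local_defect Phi cr a1 x1 b1 y1 H c • =
    sw b1 c (fun p q => sw a1 p (fun p' q' => sw q' q (fun r s =>
      G p' r (branch (cr s x1 y1))))) -
    sw a1 b1 (fun p q => sw p c (fun p' q' => G p' q' (branch (cr q x1 y1)))).
  congr (_ - _); apply: eq_sweedler => p q; apply: eq_sweedler => p' q'.
    exact: two_cell.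
  exact: one_cell.
have E := etrans (esym (defectE a x b y))
  (etrans (local_defect_vertex a x b y c Hb) (defectE b y a x)).
apply/eqP; rewrite -subr_eq0; apply/eqP; apply: etrans (etrans E _).
  congr (_ - _); apply: eq_sweedler => p q; apply: eq_sweedler => p' q'.
    by apply: eq_sweedler => r s; rewrite branchxy.
  by rewrite branchxy.
rewrite -[RHS](subrr 0); congr (_ - _); apply: sweedler_eq0 => p q;
  apply: sweedler_eq0 => p' q'.
  apply: sweedler_eq0 => r s; rewrite branchyx; exact: (linear_at0 (G3 _ _)).
rewrite branchyx; exact: (linear_at0 (G3 _ _)).
Qed.

End Necessity.

(** Without decorations there are no trees and the space is zero, hence [inhabited D] in the
    equivalence. *)
Theorem theorem2p2 (K : fieldType) (charK : [pchar K]%R =i pred0)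
    (A : lmodType K) (Phi : {linear (A ⊗ A)%type -> (A ⊗ A)%type})
    (D : Type) :
  (inhabited D ->
     (phi_prelie Phi (@circ K A D Phi) <-> lCEDS Phi)) /\
  (lCEDS Phi -> free_phi_prelie Phi (@circ K A D Phi) (@vertex K A D)).
Proof.
split; last exact: typed_trees_free.
move=> [d]; split; last exact: circ_phi_prelie.
move=> prelie_circ.
have tri := tens3_trilinear A; have [G1 G2 G3] := tri.
have tri' : trilinear (fun u v w : A => (w ⊗ u) ⊗ v).
  by split=> u v; [exact: G2|exact: G3|exact: G1].
have [[e e0]|A0] := pselect (exists e : A, e != 0).
  have [phi lphi phi_e] := linear_form_through e0.
  (* Characteristic zero enters through the invertibility of 2. *)
  have two_neq0 : 2%:R != 0 :> K by rewrite (pcharf0P K).1.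
  apply: sweedler_lCEDS.
    exact: (assoc_of_prelie d prelie_circ lphi phi_e two_neq0 tri).
  exact: (comm_of_prelie d prelie_circ lphi phi_e tri').
(* If [A] is zero there is no [e], but both axioms then compare zero tensors. *)
have {}A0 (u : A) : u = 0.
  by apply: contrapT => /eqP u0; apply: A0; exists u.
have tens0 (u v w : A) : (u ⊗ v) ⊗ w = 0.
  by rewrite (A0 w) (linear_at0 (G3 u v)).
apply: sweedler_lCEDS => a b c.
  transitivity (0 : ((A ⊗ A) ⊗ A)%type); last apply: esym.
    apply: sweedler_eq0 => p q; apply: sweedler_eq0 => p' q'.
    by apply: sweedler_eq0 => r s; exact: tens0.
  by apply: sweedler_eq0 => p q; apply: sweedler_eq0 => p' q'; exact: tens0.
transitivity (0 : ((A ⊗ A) ⊗ A)%type); last apply: esym;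
  by apply: sweedler_eq0 => p q; apply: sweedler_eq0 => p' q'; exact: tens0.
Qed.
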